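(* Consider the Poisson sampling model described in the context. For any $C>0$, there exists an absolute constant $c>0$ such that for any $k\in[\sqrt n, n^C]$ and any threshold $y_0\in\mathbb{N}$, the modified Good--Turing estimator $\widehat p^{\rm MGT}$ with threshold $y_0$ satisfies $$\mathrm{Reg}(\widehat p^{\rm MGT})\ge \frac{c}{\sqrt{n\log n}}.$$
   Context: Poisson sampling model: for an unknown $p^\star\in\Delta_k$ (the probability simplex in $\mathbb{R}^k$), one observes independent counts $N_i\sim\mathrm{Poi}(np_i^\star)$, $i\in[k]$. Risk: $r_n(p^\star,\widehat p)=\mathbb{E}_{p^\star}D_{KL}(p^\star\|\widehat p)$. An estimator is permutation invariant (PI) if $\widehat p(\pi(N))=\pi(\widehat p(N))$ for all permutations $\pi$ of $[k]$, where $\pi(y)=(y_{\pi(1)},\dots,y_{\pi(k)})$; the PI oracle $\widehat p^{\rm PI}$ is the PI estimator (allowed to depend on $p^\star$) minimizing $r_n(p^\star,\cdot)$. Regret: $\mathrm{Reg}(\widehat p)=\sup_{p^\star\in\Delta_k}[r_n(p^\star,\widehat p)-r_n(p^\star,\widehat p^{\rm PI})]$. Profiles: $\Phi_y=\sum_{i=1}^k\mathbf{1}\{N_i=y\}$. Modified Good--Turing estimator with threshold $y_0$: $\widehat p^{\rm MGT}_i\propto \frac{N_i+1}{n}\cdot\frac{\Phi_{N_i+1}+1}{\Phi_{N_i}}$ if $N_i\le y_0$, and $\widehat p^{\rm MGT}_i\propto N_i/n$ otherwise, normalized to sum to one. *)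

(* Defs.v *)
From HB Require Import structures.
From mathcomp Require Import all_boot all_order all_algebra all_fingroup.
From mathcomp Require Import all_classical all_reals all_analysis.
Set Implicit Arguments. Unset Strict Implicit. Unset Printing Implicit Defensive.
Import Order.TTheory GRing.Theory Num.Theory.
Local Open Scope ring_scope.
Local Open Scope classical_set_scope.

Section Defs.
Variable R : realType.

Definition counts (k : nat) := {ffun 'I_k -> nat}.

Definition simplex (k : nat) : set ('I_k -> R) :=
  [set p | (forall i, 0 <= p i) /\ \sum_(i < k) p i = 1].

(* Poisson pmf P(Poi(r) = m) = r^m / m! * e^{-r}  (r >= 0; for r = 0 it is
   the point mass at 0, since 0^0 = 1). *)
Definition poi (r : R) (m : nat) : R := r ^+ m / (m`!)%:R * expR (- r).

Definition poi_prob (n : nat) (k : nat) (p : 'I_k -> R) (N : counts k) : R :=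
  \prod_(i < k) poi (n%:R * p i) (N i).

Definition KL (k : nat) (p q : 'I_k -> R) : \bar R :=
  (\sum_(i < k)
     (if (p i == 0)%R then 0%E
      else if (q i == 0)%R then +oo%E
      else (p i * ln (p i / q i))%R%:E))%E.

Definition estimator (k : nat) := counts k -> ('I_k -> R).

Definition risk (n k : nat) (p : 'I_k -> R) (ph : estimator k) : \bar R :=
  (\esum_(N in [set: counts k]) ((poi_prob n p N)%:E * KL p (ph N)))%E.

Definition perm_counts (k : nat) (s : {perm 'I_k}) (N : counts k) : counts k :=
  [ffun i => N (s i)].

Definition PI_estimator (k : nat) (ph : estimator k) : Prop :=
  (forall N, @simplex k (ph N)) /\
  (forall (s : {perm 'I_k}) (N : counts k) (i : 'I_k),
      ph (perm_counts s N) i = ph N (s i)).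

Definition oracle_risk (n k : nat) (p : 'I_k -> R) : \bar R :=
  ereal_inf [set risk n p ph | ph in [set ph | PI_estimator ph]].

Definition regret (n k : nat) (ph : estimator k) : \bar R :=
  ereal_sup [set (risk n p ph - oracle_risk n p)%E | p in @simplex k].

Definition profile (k : nat) (N : counts k) (y : nat) : nat :=
  #|[set i : 'I_k | N i == y]|.

Definition mgt_weight (n y0 k : nat) (N : counts k) (i : 'I_k) : R :=
  if (N i <= y0)%N then
    (N i).+1%:R / n%:R * ((profile N (N i).+1).+1%:R / (profile N (N i))%:R)
  else (N i)%:R / n%:R.

Definition MGT (n y0 k : nat) : estimator k :=
  fun N i => mgt_weight n y0 N i / \sum_(j < k) mgt_weight n y0 N j.

End Defs.

Arguments MGT {R} n y0 k _ _.
Arguments regret {R} n k ph.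

(* Main.v *)
(* For p uniform on m of the k symbols, compare the modified Good-Turing
   estimator Q with the permutation invariant estimator obtained by averaging Q
   over the observed symbols.  The risk difference is the expectation of
   m^-1 * \sum_(i seen) ln (mean / Q i), which dominates the squared relative
   deviation ((Q i - Q j) / (Q i + Q j))^2 of any two observed symbols i, j, and
   also the average of these squares over all pairs; the normalization of Q
   drops out of the deviations.

   Let s = floor (sqrt n).  If y0 >= 4 s, take m = s and the largest y at which
   the Poisson mass is at least 1 / (16 s).  With probability bounded below,
   exactly one symbol has count y, exactly one has count y + 1 and none has
   count y + 2; the Good-Turing factors of these two symbols are then 2 and 1,
   so they deviate by a constant, at cost of order 1 / m.  If y0 < 4 s, take
   m = s / 16: all counts exceed y0, the estimator is the empirical one, and two
   independent counts differ by order sqrt s, so that every pair has squared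
   deviation of order 1 / s.  The finitely many n with s < 128 are covered by
   m = 2 and the counts (1, 2). *)
Require Import Defs.
From HB Require Import structures.
From mathcomp Require Import all_boot all_order all_algebra all_fingroup.
From mathcomp Require Import all_classical all_reals all_analysis.
From mathcomp Require Import finmap ring lra zify.
Import Order.TTheory GRing.Theory Num.Theory. Import numFieldNormedType.Exports.
Local Open Scope ring_scope.


(** * Logarithmic loss of a positive vector against its mean *)

Section LogDeviation.
Variable R : realType.

Lemma ln_le_subr1 (x : R) : 0 < x -> ln x <= x - 1.
Proof.
move=> x0; have -> : ln x = ln (1 + (x - 1)) by congr ln; ring.
by apply: le_ln1Dx; lra.
Qed.

(* Split [ln x + ln y] as [2 ln u + ln (x y / u^2)] with [u] the mean of [x] and [y],
   and apply [ln t <= t - 1] to both terms. *)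
Lemma log_gap_pair (x y : R) : 0 < x -> 0 < y ->
  ((x - y) / (x + y)) ^+ 2 <= (x - 1 - ln x) + (y - 1 - ln y).
Proof.
move=> x0 y0; have s0 : 0 < x + y by lra.
pose u := (x + y) / 2; have u0 : 0 < u by rewrite /u; lra.
have h1 := ln_le_subr1 _ u0.
have r0 : 0 < x * y / (u * u) by rewrite divr_gt0 // mulr_gt0.
have h2 := ln_le_subr1 _ r0.
have h3 : ln (x * y / (u * u)) = ln x + ln y - (ln u + ln u).
  by rewrite ln_div ?posrE ?mulr_gt0 // !lnM ?posrE.
have h4 : ((x - y) / (x + y)) ^+ 2 = 1 - x * y / (u * u).
  by rewrite /u; field; rewrite gt_eqF.
have h5 : u + u = x + y by rewrite /u; field.
by rewrite h4; lra.
Qed.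

Lemma dev_scale (x y a : R) : 0 < x -> 0 < y -> 0 < a ->
  (x / a - y / a) / (x / a + y / a) = (x - y) / (x + y).
Proof.
move=> x0 y0 a0; rewrite -mulrBl -mulrDl; field.
by rewrite !gt_eqF // addr_gt0.
Qed.

Variables (I : finType) (J : pred I) (q : I -> R).
Hypothesis q_gt0 : forall i, 0 < q i.
Let a := (\sum_(i | J i) q i) / (#|J|)%:R.

Lemma mean_gt0 i : J i -> 0 < a.
Proof.
move=> Ji; rewrite /a divr_gt0 //.
  by rewrite (bigD1 i) //= ltr_pwDl // sumr_ge0 // => l _; exact: ltW.
by rewrite ltr0n; apply/card_gt0P; exists i.
Qed.

(** The ratios [q i / a] have mean 1 over [J], so the added terms cancel in the sum; afterwards
    every summand is nonnegative on its own. *)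
Lemma log_meanE i0 : J i0 ->
  \sum_(i | J i) ln (a / q i) = \sum_(i | J i) (q i / a - 1 - ln (q i / a)).
Proof.
move=> Ji0; have a0 := mean_gt0 _ Ji0.
have card0 : (#|J|)%:R != 0 :> R.
  by rewrite pnatr_eq0 -lt0n; apply/card_gt0P; exists i0.
have s0 : \sum_(i | J i) q i != 0.
  by apply: contraTneq a0 => s0; rewrite /a s0 mul0r ltxx.
have h : \sum_(i | J i) (q i / a - 1) = 0.
  by rewrite sumrB -mulr_suml sumr_const /a; field; rewrite card0 s0.
rewrite sumrB h sub0r -sumrN.
by apply: eq_bigr => i _; rewrite -(lnV (divr_gt0 (q_gt0 i) a0)) invf_div.
Qed.

Lemma log_gap_ge0 (x : R) : 0 < x -> 0 <= x - 1 - ln x.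
Proof. by move=> x0; have := ln_le_subr1 _ x0; lra. Qed.

Lemma log_mean_ge0 : 0 <= \sum_(i | J i) ln (a / q i).
Proof.
case: (pickP J) => [i Ji|J0]; last by rewrite big_pred0.
rewrite (log_meanE _ Ji) sumr_ge0 // => l _; apply: log_gap_ge0.
by rewrite divr_gt0 // (mean_gt0 _ Ji).
Qed.

Lemma log_mean_ge_pair i j : J i -> J j -> i != j ->
  ((q i - q j) / (q i + q j)) ^+ 2 <= \sum_(l | J l) ln (a / q l).
Proof.
move=> Ji Jj ij; have a0 := mean_gt0 _ Ji.
rewrite (log_meanE _ Ji) (bigD1 i) //= (bigD1 j) /=; last by rewrite Jj eq_sym.
have p0 l : 0 < q l / a by rewrite divr_gt0.
rewrite addrA -(dev_scale (q i) (q j) a) //; apply: (le_trans (log_gap_pair _ _ (p0 i) (p0 j))).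
rewrite lerDl sumr_ge0 // => l _; apply: log_gap_ge0.
by rewrite divr_gt0.
Qed.

(** Summing [log_gap_pair] over all ordered pairs uses each index [2 * #|J|] times. *)
Lemma log_mean_ge_all :
  \sum_(i | J i) \sum_(j | J j) ((q i - q j) / (q i + q j)) ^+ 2
  <= 2 * (#|J|)%:R * \sum_(l | J l) ln (a / q l).
Proof.
case: (pickP J) => [i0 Ji|J0]; last by rewrite !(big_pred0 _ _ _ _ J0) mulr0.
have a0 := mean_gt0 _ Ji.
rewrite (log_meanE _ Ji); set F := fun i => q i / a - 1 - ln (q i / a).
apply: (@le_trans _ _ (\sum_(i | J i) \sum_(j | J j) (F i + F j))).
  apply: ler_sum => i _; apply: ler_sum => j _.
  by rewrite -(dev_scale (q i) (q j) a) //; apply: log_gap_pair; rewrite divr_gt0.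
under eq_bigr do rewrite big_split /= sumr_const.
rewrite big_split /= sumr_const -sumrMnl.
have aux (n : nat) (x : R) : x *+ n + x *+ n <= 2 * n%:R * x.
  by rewrite -mulrA !mulr_natl mulr2n.
apply: le_trans (aux _ _); rewrite sumrMnl; exact: lexx.
Qed.

End LogDeviation.


(** * Poisson masses: normalization, tails and a bound on the maximum *)

Section Poisson.
Variable R : realType.
Implicit Types (r : R) (m n K : nat).

Lemma poi_ge0 r m : 0 <= r -> 0 <= poi r m.
Proof.
by move=> r0; rewrite /poi !mulr_ge0 ?exprn_ge0 ?invr_ge0 ?ler0n ?expR_ge0.
Qed.

Lemma poi_gt0 r m : 0 < r -> 0 < poi r m.
Proof.
by move=> r0; rewrite /poi !mulr_gt0 ?exprn_gt0 ?invr_gt0 ?ltr0n ?fact_gt0 ?expR_gt0.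
Qed.

Lemma poiS r m : poi r m.+1 = poi r m * (r / m.+1%:R).
Proof.
rewrite /poi exprS factS natrM; field.
by rewrite addrC natr1 !pnatr_eq0 -!lt0n fact_gt0.
Qed.

Lemma poi_0 m : poi (0 : R) m = (m == 0)%:R.
Proof.
rewrite /poi oppr0 expR0 mulr1 expr0n; case: m => [|m]; last by rewrite mul0r.
by rewrite fact0 divr1.
Qed.

Let poi_seriesE r K :
  \sum_(m < K) poi r m = series (exp_coeff r) K * expR (- r).
Proof. by rewrite /series /= big_mkord mulr_suml. Qed.

Let exp_series_nd r : 0 <= r -> {homo series (exp_coeff r) : m n / (m <= n)%N >-> m <= n}.
Proof.
move=> r0; apply/nondecreasing_seqP => n; rewrite /series /= big_nat_recr //=.
by rewrite lerDl /exp_coeff /= mulr_ge0 ?exprn_ge0 ?invr_ge0 ?ler0n.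
Qed.

Lemma poi_sum_le1 r K : 0 <= r -> \sum_(m < K) poi r m <= 1.
Proof.
move=> r0; rewrite poi_seriesE -(expRxMexpNx_1 r) ler_wpM2r ?expR_ge0 //.
apply: nondecreasing_cvgn_le; first exact: exp_series_nd.
exact: is_cvg_series_exp_coeff.
Qed.

Lemma poi_le1 r m : 0 <= r -> poi r m <= 1.
Proof.
move=> r0; apply: le_trans (poi_sum_le1 r m.+1 r0); rewrite big_ord_recr /=.
by rewrite lerDr sumr_ge0 // => i _; exact: poi_ge0.
Qed.

Lemma poi_sum_near1 r (e : R) : 0 <= r -> 0 < e ->
  exists K0, forall K, (K0 <= K)%N -> 1 - e <= \sum_(m < K) poi r m.
Proof.
move=> r0 e0.
have cv : ((fun K => \sum_(m < K) poi r m) @ \oo --> (1 : R))%classic.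
  under eq_fun do rewrite poi_seriesE.
  rewrite -(expRxMexpNx_1 r); apply: cvgMl.
  exact: is_cvg_series_exp_coeff.
move/cvgrPdist_le: cv => /(_ e e0)[K0 _ H]; exists K0 => K KK.
by have := H K KK; rewrite ler_norml => /andP[_]; lra.
Qed.

Lemma poi_upper_half r y : 0 <= r -> 2 * r <= y.+1%:R ->
  2 * poi r y.+1 <= poi r y.
Proof.
move=> r0 ry; rewrite poiS mulrCA ler_piMr ?poi_ge0 // mulrA ler_pdivrMr ?ltr0n //.
by rewrite mul1r.
Qed.

Lemma poi_lower_half r y : 0 < r -> 2 * y.+1%:R <= r ->
  2 * poi r y <= poi r y.+1.
Proof.
move=> r0 ry; rewrite poiS mulrC ler_wpM2l ?(poi_ge0 _ _ (ltW r0)) //.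
by rewrite ler_pdivlMr ?ltr0n.
Qed.

Lemma poi_upper_geo r y j : 0 <= r -> 2 * r <= y%:R ->
  2 ^+ j * poi r (y + j) <= 1.
Proof.
move=> r0 ry; elim: j => [|j IH]; first by rewrite addn0 expr0 mul1r poi_le1.
apply: le_trans IH; rewrite exprSr -mulrA ler_wpM2l ?exprn_ge0 // addnS.
apply: poi_upper_half => //; apply: le_trans ry _.
by rewrite ler_nat -addnS leq_addr.
Qed.

Lemma poi_upper_tail r y n : 0 <= r -> 2 * r <= y%:R ->
  \sum_(i < n) poi r (y + i) <= 2 * poi r y.
Proof.
move=> r0 ry.
(* The induction carries [2 * poi r (y + n)], a geometric bound for the tail not yet summed; halving
   pays for each new term. *)
suff : \sum_(i < n) poi r (y + i) + 2 * poi r (y + n) <= 2 * poi r y.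
  by apply: le_trans; rewrite lerDl mulr_ge0 // poi_ge0.
elim: n => [|n IH]; first by rewrite big_ord0 addn0 add0r.
apply: le_trans IH; rewrite big_ord_recr /=.
have := @poi_upper_half r (y + n) r0; rewrite addnS => H.
have /H : 2 * r <= (y + n).+1%:R.
  by apply: le_trans ry _; rewrite ler_nat -addnS leq_addr.
lra.
Qed.

(** Up to [r / 2] the masses at least double at each step, so each one dominates the sum of all
    earlier ones. *)
Lemma poi_lower_tail r y : 0 < r -> 2 * y%:R <= r ->
  \sum_(i < y) poi r i <= poi r y.
Proof.
move=> r0; elim: y => [|y IH] ry; first by rewrite big_ord0 poi_ge0 // ltW.
rewrite big_ord_recr /=; have := poi_lower_half _ _ r0 ry.
have /IH : 2 * y%:R <= r by apply: le_trans ry; rewrite ler_pM2l // ler_nat.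
lra.
Qed.

(** Keeps powers such as [(1 - 1 / (2 n)) ^+ n] at least 1/2. *)
Lemma bernoulli (x : R) n : 0 <= x <= 1 -> 1 - n%:R * x <= (1 - x) ^+ n.
Proof.
move=> /andP[x0 x1]; elim: n => [|n IH]; first by rewrite expr0; lra.
rewrite exprS; apply: le_trans (_ : (1 - x) * (1 - n%:R * x) <= _); last first.
  by rewrite ler_wpM2l // subr_ge0.
rewrite -natr1; have : 0 <= n%:R * x * x by rewrite !mulr_ge0 // ler0n.
lra.
Qed.

Lemma poi_window r a J : 0 <= r -> \sum_(i < J) poi r (a + i) <= 1.
Proof.
move=> r0; apply: le_trans (poi_sum_le1 r (a + J) r0).
rewrite big_split_ord /= lerDr sumr_ge0 // => i _; exact: poi_ge0.
Qed.

(* The masses at the [J] points next to [y] on the side of [r] are at least half the mass at [y]. *)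
Lemma poi_max r (J y : nat) : (0 < J)%N -> 2 * (J * J)%:R <= r ->
  J%:R * poi r y <= 2.
Proof.
move=> J0 Jr; have j1 : 1 <= J%:R :> R by rewrite ler1n.
rewrite natrM in Jr; set j := J%:R in j1 Jr *.
have r0 : 0 < r by nra.
have jr : j <= r by nra.
have x01 : 0 <= j / r <= 1.
  by apply/andP; split; [apply: divr_ge0; lra | rewrite ler_pdivrMr // mul1r].
have half i : (i <= J)%N -> 1 / 2 <= (1 - j / r) ^+ i.
  move=> iJ; apply: le_trans (bernoulli _ _ x01).
  have ij : i%:R <= j by rewrite ler_nat.
  have : i%:R * (j / r) <= 1 / 2.
    rewrite mulrA ler_pdivrMr //; have i0 : 0 <= i%:R :> R by rewrite ler0n.
    by nra.
  lra.
suff [a Ha] : exists a, forall i, (i < J)%N -> poi r y / 2 <= poi r (a + i).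
  have := poi_window r a J (ltW r0).
  have : \sum_(i < J) poi r y / 2 <= \sum_(i < J) poi r (a + i).
    by apply: ler_sum => i _; exact: Ha.
  rewrite sumr_const card_ord -mulr_natl -/j; lra.
have p0 := poi_ge0 r _ (ltW r0).
have key i : (i <= J)%N -> poi r y / 2 <= poi r y * (1 - j / r) ^+ i.
  by move=> iJ; rewrite ler_wpM2l // -div1r half.
(* The window is [[y - J, y)] if [r <= y] and [[y, y + J)] otherwise. Each step away from [y] inside
   it multiplies the mass by at least [1 - j / r], and at most [J] steps lose at most a factor 2,
   since [J ^ 2 / r <= 1 / 2]. *)
case: (leP r y%:R) => ry.
  have Jy : (J <= y)%N by rewrite -(ler_nat R) (le_trans jr).
  exists (y - J)%N => i iJ.
  have -> : (y - J + i = y - (J - i))%N by lia.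
  apply: le_trans (key (J - i)%N (leq_subr _ _)) _.
  elim: (J - i)%N (leq_subr i J) => [|l IH] lJ; first by rewrite expr0 mulr1 subn0.
  apply: le_trans (_ : (1 - j / r) * poi r (y - l) <= _).
    rewrite exprS mulrCA ler_wpM2l ?IH ?(ltnW lJ) //; lra.
  have -> : (y - l = (y - l.+1).+1)%N by lia.
  rewrite poiS mulrCA ler_piMr // mulrA ler_pdivrMr ?ltr0n // mul1r.
  rewrite mulrBl mul1r divfK ?gt_eqF // lerBlDr.
  have -> : (y - l.+1).+1%:R = y%:R - l%:R :> R by rewrite -natrB; [congr (_%:R); lia|lia].
  have : l%:R <= j by rewrite ler_nat ltnW.
  lra.
exists y => i iJ.
apply: le_trans (key i (ltnW iJ)) _.
elim: i iJ => [|l IH] lJ; first by rewrite expr0 mulr1 addn0.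
apply: le_trans (_ : (1 - j / r) * poi r (y + l) <= _).
  rewrite exprS mulrCA ler_wpM2l ?IH ?(ltnW lJ) //; lra.
rewrite addnS poiS mulrC ler_wpM2l //.
have l0 : 0 < (y + l).+1%:R :> R by rewrite ltr0n.
rewrite ler_pdivlMr //.
have : (y + l).+1%:R <= r + j.
  rewrite -addnS natrD; have : l.+1%:R <= j by rewrite ler_nat ltnW.
  by lra.
have -> : r + j = r + j / r * r by rewrite divfK ?gt_eqF.
move: x01 => /andP[]; set u := j / r; set t := (y + l).+1%:R => u0 u1 tr.
have := mulr_ge0 (mulr_ge0 u0 u0) (ltW r0).
have : (1 - u) * t <= (1 - u) * (r + u * r) by rewrite ler_wpM2l // subr_ge0.
lra.
Qed.
End Poisson.


(** * Finite boxes of count vectors *)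

Section Box.
Variable R : realType.

(* Expectations are bounded below by finite sums over the boxes [0, K)^k. *)
Definition box (k K : nat) (f : {ffun 'I_k -> 'I_K}) : counts k :=
  [ffun i => f i : nat].

Lemma box_inj k K : injective (@box k K).
Proof.
by move=> f g /ffunP fg; apply/ffunP => i; apply: val_inj; have := fg i; rewrite !ffunE.
Qed.

Lemma sum_box_prod k K (g : 'I_k -> nat -> R) :
  \sum_(f : {ffun 'I_k -> 'I_K}) \prod_(i < k) g i (box _ _ f i)
  = \prod_(i < k) \sum_(y < K) g i y.
Proof.
rewrite bigA_distr_bigA; apply: eq_bigr => f _.
by apply: eq_bigr => i _; rewrite ffunE.
Qed.

Lemma sum_box_le_esum k K (a : counts k -> \bar R) :
  (\sum_(f : {ffun 'I_k -> 'I_K}) a (box _ _ f) <= \esum_(N in [set: counts k]) a N)%E.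
Proof.
apply: esum_ge; exists [set` [fset box _ _ f | f in {ffun 'I_k -> 'I_K}]%fset]%classic.
  by split; [exact: finite_fset|].
rewrite fsbig_finite //= set_fsetK big_imfset /=; last by move=> ? ? _ _; exact: box_inj.
by rewrite big_enum /=.
Qed.

Lemma poi_prob_ge0 n k (p : 'I_k -> R) (N : counts k) :
  (forall i, 0 <= p i) -> 0 <= poi_prob n p N.
Proof. by move=> p0; apply: prodr_ge0 => i _; rewrite poi_ge0 // mulr_ge0. Qed.

Lemma esum_poi_prob_le1 n k (p : 'I_k -> R) : (forall i, 0 <= p i) ->
  (\esum_(N in [set: counts k]) (poi_prob n p N)%:E <= 1)%E.
Proof.
move=> p0; apply: ge_ereal_sup => _ [A [finA _] <-].
rewrite fsbig_finite //=.
(* A number above all counts of all vectors in [A], so that [A] lies in a single box. *)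
pose K := (\sum_(N <- fset_set A) \sum_(i < k) N i).+1.
have AK N : N \in fset_set A -> exists f, N = box k K f.
  move=> NA; have NK i : (N i < K)%N.
    rewrite ltnS (big_rem N) //= (bigD1 i) //= -addnA; exact: leq_addr.
  by exists [ffun i => Ordinal (NK i)]; apply/ffunP => i; rewrite !ffunE.
apply: (@le_trans _ _ (\sum_(f : {ffun 'I_k -> 'I_K}) (poi_prob n p (box _ _ f))%:E)%E).
  pose B := [fset box _ _ f | f in {ffun 'I_k -> 'I_K}]%fset.
  apply: (@le_trans _ _ (\sum_(N <- B) (poi_prob n p N)%:E)%E); last first.
    by rewrite big_imfset /= ?big_enum //=; move=> ? ? _ _; exact: box_inj.
  apply: lee_sum_nneg_subfset.
    by move=> N /AK[f ->]; apply/imfsetP; exists f.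
  by move=> N _ _; rewrite lee_fin poi_prob_ge0.
rewrite sumEFin lee_fin (sum_box_prod k K (fun i => poi (n%:R * p i))).
apply: numdomain.Num.Theory.prodr_ile1 => i _.
rewrite poi_sum_le1 ?mulr_ge0 // andbT sumr_ge0 // => y _.
by rewrite poi_ge0 // mulr_ge0.
Qed.

End Box.
Arguments box {k K}.

(** * Regret bounded below by the gain from averaging over the seen symbols *)

Section Regret.
Variables (R : realType) (n k : nat).

Definition uniform_on (m : nat) : 'I_k -> R := fun i => if (i < m)%N then m%:R^-1 else 0.

Lemma uniform_on_simplex m : (0 < m <= k)%N -> simplex (uniform_on m).
Proof.
move=> /andP[m0 mk]; split=> [i|]; first by rewrite /uniform_on; case: ifP.
rewrite -big_mkcond /= -(big_ord_widen _ (fun=> m%:R^-1)) // sumr_const card_ord.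
by rewrite -[LHS]mulr_natl divff // pnatr_eq0 -lt0n.
Qed.

Definition KLr (p q : 'I_k -> R) : R := \sum_(i < k) p i * ln (p i / q i).

Lemma KL_EFin p q : (forall i, 0 < q i) -> KL p q = (KLr p q)%:E.
Proof.
move=> q0; rewrite /KL /KLr -sumEFin; apply: eq_bigr => i _.
by case: eqP => [->|_]; rewrite ?mul0r // (gt_eqF (q0 i)).
Qed.

(** Gibbs' inequality, by the termwise bound [p ln (p / q) >= p - q]. *)
Lemma KLr_ge0 p q : simplex p -> simplex q -> (forall i, 0 < q i) -> 0 <= KLr p q.
Proof.
move=> [p0 p1] [_ q1] q0; rewrite -(subrr 1) -{1}p1 -q1 -sumrB.
apply: ler_sum => i _; have [->|pi0] := eqVneq (p i) 0.
  by rewrite mul0r sub0r oppr_le0 ltW.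
have pi1 : 0 < p i by rewrite lt_neqAle eq_sym pi0 p0.
have := ln_le_subr1 _ _ (divr_gt0 (q0 i) pi1).
rewrite -[p i / q i]invf_div lnV ?posrE ?divr_gt0 // => H.
apply: le_trans (_ : p i * (1 - q i / p i) <= _).
  by rewrite mulrBr mulr1 mulrCA divff ?mulr1.
by rewrite ler_wpM2l //; lra.
Qed.

Variable Q : estimator R k.
Hypothesis Q_PI : PI_estimator Q.
Hypothesis Q_gt0 : forall N i, 0 < Q N i.

Definition seen (N : counts k) : pred 'I_k := fun i => N i != 0%N.
Definition seen_mean (N : counts k) : R := (\sum_(i | seen N i) Q N i) / (#|seen N|)%:R.

(* Permutation invariant like [Q], hence an upper bound for the oracle risk. *)
Definition flatten_seen : estimator R k :=
  fun N i => if seen N i then seen_mean N else Q N i.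

Definition seen_gain (N : counts k) : R :=
  \sum_(i | seen N i) ln (seen_mean N / Q N i).

Lemma flatten_seen_gt0 N i : 0 < flatten_seen N i.
Proof. by rewrite /flatten_seen; case: ifP => // /mean_gt0 ->. Qed.

Lemma flatten_seen_PI : PI_estimator flatten_seen.
Proof.
have [Qs Qp] := Q_PI; split=> [N|s N i].
  split=> [i|]; first by rewrite ltW ?flatten_seen_gt0.
  rewrite -(Qs N).2 (bigID (seen N)) /= [RHS](bigID (seen N)) /=; congr (_ + _).
    rewrite (eq_bigr (fun=> seen_mean N)) => [|i iN]; last by rewrite /flatten_seen iN.
    case: (pickP (seen N)) => [i0 Ni0|N0]; last by rewrite !big_pred0.
    rewrite sumr_const -[LHS]mulr_natr /seen_mean divfK // pnatr_eq0 -lt0n.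
    by apply/card_gt0P; exists i0.
  by apply: eq_bigr => i /negbTE iN; rewrite /flatten_seen iN.
have seenE j : seen (perm_counts s N) j = seen N (s j) by rewrite /seen ffunE.
rewrite /flatten_seen seenE Qp; case: ifP => // _; congr (_ / _).
  rewrite [RHS](reindex_inj (@perm_inj _ s)) /=.
  by apply: eq_big => [j|j _]; rewrite ?seenE ?Qp.
rewrite -!sum1_card [in RHS](reindex_inj (@perm_inj _ s)) /=.
by congr (_ %:R); apply: eq_bigl => j; exact: seenE.
Qed.

(** The two estimators differ only on seen symbols, and these lie in the support, where the true
    distribution has the constant value [1 / m]. *)
Lemma KLr_flatten_seen m (N : counts k) : (forall i : 'I_k, (m <= i)%N -> N i = 0%N) ->
  KLr (uniform_on m) (Q N) =
  KLr (uniform_on m) (flatten_seen N) + m%:R^-1 * seen_gain N.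
Proof.
move=> N0; rewrite /seen_gain mulr_sumr [X in _ + X]big_mkcond -big_split /=.
apply: eq_bigr => i _; rewrite /flatten_seen; case: ifPn => [Ni|_]; last by rewrite addr0.
have im : (i < m)%N by rewrite ltnNge; apply: contra Ni => /N0 ->.
rewrite /uniform_on im -mulrDr; congr (_ * _).
have m0 : (0 : R) < m%:R^-1 by rewrite invr_gt0 ltr0n (leq_ltn_trans _ im).
have a0 : 0 < seen_mean N by apply: mean_gt0 Ni.
have lnB (x y : R) : 0 < x -> 0 < y -> ln (x / y) = ln x - ln y.
  by move=> x0 y0; rewrite ln_div.
by move: (seen_mean N) a0 => a a0; rewrite !lnB // addrA subrK.
Qed.

Lemma poi_prob_unseen m (N : counts k) (i : 'I_k) : (m <= i)%N -> N i != 0%N ->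
  poi_prob n (uniform_on m) N = 0.
Proof.
move=> mi Ni; rewrite /poi_prob (bigD1 i) //= /uniform_on ltnNge mi /= mulr0 poi_0.
by rewrite (negbTE Ni) mul0r.
Qed.

(** The constant estimator equal to the uniform distribution on all [k] symbols is permutation
    invariant and has finite risk. This rules out the difference [+oo - +oo] in the regret, whose
    value is [-oo]. *)
Lemma oracle_risk_lt_pinfty m : (0 < m <= k)%N ->
  (oracle_risk n (uniform_on m) < +oo)%E.
Proof.
move=> mk; have k0 : (0 < k)%N by case/andP: mk; exact: leq_trans.
have [p0 _] := uniform_on_simplex _ mk.
pose u : 'I_k -> R := fun=> k%:R^-1.
have u0 i : 0 < u i by rewrite invr_gt0 ltr0n.
have us : simplex u.
  split=> [i|]; first exact: ltW.
  by rewrite sumr_const card_ord -[LHS]mulr_natl divff // pnatr_eq0 -lt0n.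
have D0 := KLr_ge0 _ _ (uniform_on_simplex _ mk) us u0.
apply: (@le_lt_trans _ _ (risk n (uniform_on m) (fun=> u))).
  by apply: ereal_inf_lbound; exists (fun=> u).
apply: (@le_lt_trans _ _ (KLr (uniform_on m) u)%:E); last exact: ltry.
apply: ge_ereal_sup => _ [A [finA AT] <-].
rewrite KL_EFin //.
rewrite fsbig_finite //= -ge0_sume_distrl; last by move=> N _; rewrite lee_fin poi_prob_ge0.
rewrite -[leRHS]mul1e lee_wpmul2r // -fsbig_finite //.
apply: le_trans (esum_poi_prob_le1 _ n k _ p0).
by apply: ereal_sup_ubound; exists A.
Qed.

(** [flatten_seen] bounds the oracle risk from above, so at [uniform_on m] the regret is at least
    the expected [seen_gain] divided by [m]. All terms are nonnegative, so the expectation may be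
    cut down to a box. *)
Lemma regret_ge_box m K : (0 < m <= k)%N ->
  ((m%:R^-1 * \sum_(f : {ffun 'I_k -> 'I_K})
     poi_prob n (uniform_on m) (box f) * seen_gain (box f))%:E <= regret n k Q)%E.
Proof.
move=> mk; have [p0 p1] := uniform_on_simplex _ mk.
set p := uniform_on m in p0 p1 *; set L := _ * _.
have P0 N : 0 <= poi_prob n p N by exact: poi_prob_ge0.
have G0 N : 0 <= m%:R^-1 * seen_gain N.
  by rewrite mulr_ge0 // log_mean_ge0.
have K0 q N : PI_estimator q -> (forall i, 0 < q N i) -> 0 <= KLr p (q N).
  by move=> [qs _] q0; apply: KLr_ge0 => //; exact: uniform_on_simplex.
have riskE : (risk n p Q = risk n p flatten_seen
    + \esum_(N in [set: counts k]) (poi_prob n p N * (m%:R^-1 * seen_gain N))%:E)%E.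
  rewrite /risk -esumD; first last.
  - by move=> N _; rewrite lee_fin mulr_ge0.
  - move=> N _; rewrite KL_EFin; last exact: flatten_seen_gt0.
    by rewrite mule_ge0 // lee_fin // K0 //; [exact: flatten_seen_PI|exact: flatten_seen_gt0].
  apply: eq_esum => N _.
  rewrite !KL_EFin //; last exact: flatten_seen_gt0.
  rewrite -!EFinM -EFinD -mulrDr; congr (_ %:E).
  have [->|PN] := eqVneq (poi_prob n p N) 0; first by rewrite !mul0r.
  congr (_ * _); apply: KLr_flatten_seen => i mi; apply/eqP.
  by apply: contra_neqT PN => Ni; exact: (poi_prob_unseen _ _ i).
have LE : (L%:E <= \esum_(N in [set: counts k]) (poi_prob n p N * (m%:R^-1 * seen_gain N))%:E)%E.
  apply: le_trans (sum_box_le_esum _ k K _); rewrite sumEFin lee_fin /L mulr_sumr.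
  by apply: ler_sum => f _; rewrite mulrCA.
apply: (@le_trans _ _ (risk n p Q - oracle_risk n p)%E); last first.
  by apply: ereal_sup_ubound; exists p => //; exact: uniform_on_simplex.
have oo := oracle_risk_lt_pinfty _ mk; rewrite -/p in oo.
have o1 : (oracle_risk n p <= risk n p flatten_seen)%E.
  by apply: ereal_inf_lbound; exists flatten_seen => //; exact: flatten_seen_PI.
have : (risk n p flatten_seen + L%:E <= risk n p Q)%E by rewrite riskE leeD2l.
have Q0 : (0 <= risk n p Q)%E.
  by apply: esum_ge0 => N _; rewrite KL_EFin // mule_ge0 // lee_fin // K0.
move: oo o1; case: (oracle_risk n p) => [t | |] //= _; last first.
  by move=> _ _; rewrite addey ?leey // gt_eqF // (lt_le_trans _ Q0).
case: (risk n p flatten_seen) => [r | |] //=.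
  case: (risk n p Q) => [r' | |] //= h1 h2; last by rewrite leey.
  by move: h1 h2; rewrite -EFinD !lee_fin; lra.
by move=> _; rewrite addye // leye_eq => /eqP ->; rewrite addye // leey.
Qed.

End Regret.


(** * Positivity, invariance and deviations of the modified Good--Turing estimator *)

Section ModifiedGoodTuring.
Variables (R : realType) (n y0 k : nat).
Hypothesis n_gt0 : (0 < n)%N.
Local Notation w := (@mgt_weight R n y0 k).
Local Notation Q := (@MGT R n y0 k).

Lemma profileE (N : counts k) y : profile N y = #|[pred i | N i == y]|.
Proof.
apply: eq_card => i; rewrite [RHS]inE /=.
by apply/idP/idP => [/set_mem|Ni] //; exact: mem_set.
Qed.

Lemma profile_gt0 (N : counts k) i : (0 < profile N (N i))%N.
Proof. by rewrite profileE; apply/card_gt0P; exists i; rewrite inE /=. Qed.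

Lemma mgt_weight_gt0 N i : 0 < w N i.
Proof.
rewrite /mgt_weight; case: leqP => Ni.
  by rewrite mulr_gt0 ?divr_gt0 ?ltr0n ?profile_gt0.
by rewrite divr_gt0 ?ltr0n ?(leq_ltn_trans _ Ni).
Qed.

Lemma mgt_weight_sum_gt0 N (i : 'I_k) : 0 < \sum_j w N j.
Proof.
rewrite (bigD1 i) //= ltr_pwDl ?mgt_weight_gt0 // sumr_ge0 // => j _.
by rewrite ltW ?mgt_weight_gt0.
Qed.

Lemma MGT_gt0 N i : 0 < Q N i.
Proof. by rewrite divr_gt0 ?mgt_weight_gt0 ?mgt_weight_sum_gt0. Qed.

Lemma MGT_PI : (0 < k)%N -> PI_estimator Q.
Proof.
move=> k0; split=> [N|s N i].
  split=> [i|]; first by rewrite ltW ?MGT_gt0.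
  by rewrite -mulr_suml divff // gt_eqF // (mgt_weight_sum_gt0 N (Ordinal k0)).
have prof y : profile (perm_counts s N) y = profile N y.
  rewrite !profileE -!sum1_card [RHS](reindex_inj (@perm_inj _ s)) /=.
  by apply: eq_bigl => j; rewrite !inE ffunE.
have wE j : w (perm_counts s N) j = w N (s j).
  by rewrite /mgt_weight !prof ffunE.
rewrite /MGT wE; congr (_ / _); rewrite [RHS](reindex_inj (@perm_inj _ s)) /=.
by apply: eq_bigr => j _.
Qed.

Lemma MGT_dev N i j :
  (Q N i - Q N j) / (Q N i + Q N j) = (w N i - w N j) / (w N i + w N j).
Proof. by rewrite dev_scale ?mgt_weight_gt0 ?mgt_weight_sum_gt0. Qed.

Lemma MGT_gain_pair N i j : i != j -> seen _ N i -> seen _ N j ->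
  ((w N i - w N j) / (w N i + w N j)) ^+ 2 <= seen_gain _ _ Q N.
Proof.
by move=> ij si sj; rewrite -MGT_dev; apply: log_mean_ge_pair => // l; exact: MGT_gt0.
Qed.

Lemma MGT_gain_all N :
  \sum_(i | seen _ N i) \sum_(j | seen _ N j) ((w N i - w N j) / (w N i + w N j)) ^+ 2
  <= 2 * (#|seen _ N|)%:R * seen_gain _ _ Q N.
Proof.
apply: le_trans (log_mean_ge_all _ _ _ _ _); last by move=> l; exact: MGT_gt0.
by apply: ler_sum => i _; apply: ler_sum => j _; rewrite MGT_dev.
Qed.

End ModifiedGoodTuring.

(** * Expectations of functions of two counts *)

Section BoxExpectation.
Variables (R : realType) (n k m K : nat).
Local Notation P N := (poi_prob n (uniform_on R k m) N).
Let r : R := n%:R / m%:R.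

(** All [m] symbols of the support are charged a factor [x], even [i] and [j]; since [x <= 1] this
    only weakens the bound, and it avoids the exponent [m - 2]. *)
Lemma prod_ge_pow (F : 'I_k -> R) (i j : 'I_k) (x : R) :
  i != j -> 0 <= x <= 1 -> (m <= k)%N -> 0 <= F i -> 0 <= F j ->
  (forall l, l != i -> l != j -> (if (l < m)%N then x else 1) <= F l) ->
  x ^+ m * (F i * F j) <= \prod_l F l.
Proof.
move=> ij /andP[x0 x1] mk Fi Fj H.
rewrite (bigD1 i) //= (bigD1 j) 1?eq_sym //= [leRHS]mulrA [leLHS]mulrC ler_wpM2l ?mulr_ge0 //.
pose G (l : 'I_k) : R := if (l < m)%N then x else 1.
have G01 l : 0 <= G l <= 1 by rewrite /G; case: ifP; rewrite ?x0 ?x1 ?ler01 ?lexx.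
have -> : x ^+ m = \prod_l G l.
  rewrite -big_mkcond /= -(big_ord_widen _ (fun=> x)) //.
  by rewrite prodr_const card_ord.
rewrite (bigD1 i) //= (bigD1 j) 1?eq_sym //= mulrA.
apply: (@le_trans _ _ (\prod_(l | (l != i) && (l != j)) G l)).
  rewrite ler_piMl //; first by apply: prodr_ge0 => l _; case/andP: (G01 l).
  have /andP[? ?] := G01 i; have /andP[? ?] := G01 j; exact: mulr_ile1.
apply: ler_prod => l /andP[li lj]; rewrite H // andbT.
by case/andP: (G01 l).
Qed.

(** By independence the expectation factors once the values of [N i] and [N j] are fixed. Each other
    symbol of the support contributes at least [x]; a symbol off the support has count 0, where [g]
    is 1. *)
Lemma box_pair_ge (i j : 'I_k) (g : nat -> R) (h : nat -> nat -> R) (x : R) :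
  (i < m)%N -> (j < m)%N -> i != j -> (m <= k)%N -> 0 <= x <= 1 ->
  (forall t, 0 <= g t) -> (forall s t, 0 <= h s t) ->
  (0 < K)%N -> g 0%N = 1 -> x <= \sum_(t < K) poi r t * g t ->
  x ^+ m * (\sum_(s < K) \sum_(t < K) poi r s * poi r t * h s t) <=
  \sum_(f : {ffun 'I_k -> 'I_K}) P (box f) *
    (h (box f i) (box f j) * \prod_(l | (l != i) && (l != j)) g (box f l)).
Proof.
move=> im jm ij mk x01 g0 h0 K0 g1 xg.
have r0 : 0 <= r by rewrite divr_ge0.
have ji : j != i by rewrite eq_sym.
(* [h] need not be a product, so it is split over its values: [c s t] gives in product form the
   event that coordinates [i] and [j] equal [s] and [t], together with the weights [g] elsewhere. *)
pose c (s t : 'I_K) (l : 'I_k) (u : nat) : R :=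
  if l == i then (u == s)%:R else if l == j then (u == t)%:R else g u.
have pick_val (s : 'I_K) (F : 'I_K -> R) : \sum_u F u * (val u == val s)%:R = F s.
  rewrite (bigD1 s) //= eqxx mulr1 big1 ?addr0 // => u us.
  by rewrite (negbTE (us : val u != val s)) mulr0.
have -> : \sum_(f : {ffun 'I_k -> 'I_K}) P (box f) *
    (h (box f i) (box f j) * \prod_(l | (l != i) && (l != j)) g (box f l)) =
  \sum_(s < K) \sum_(t < K) h s t *
    \prod_l \sum_(u < K) poi (n%:R * uniform_on R k m l) u * c s t l u.
  have cE (f : {ffun 'I_k -> 'I_K}) s t : \prod_l (poi (n%:R * uniform_on R k m l) (box f l) * c s t l (box f l)) =
      P (box f) * \prod_(l | (l != i) && (l != j)) g (box f l)
        * (val (f i) == val s)%:R * (val (f j) == val t)%:R.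
    rewrite big_split /= -mulrA -mulrA; congr (_ * _).
    rewrite (bigD1 i) //= (bigD1 j) //= /c !eqxx (negbTE ji) !ffunE.
    rewrite mulrA mulrC; congr (_ * _); apply: eq_bigr => l /andP[li lj].
    by rewrite (negbTE li) (negbTE lj).
  have E1 (s t : 'I_K) : h s t *
      \prod_l \sum_(u < K) poi (n%:R * uniform_on R k m l) u * c s t l u =
      \sum_(f : {ffun 'I_k -> 'I_K}) h s t * (P (box f) * \prod_(l | (l != i) && (l != j)) g (box f l)
        * (val (f i) == val s)%:R * (val (f j) == val t)%:R).
    rewrite -(sum_box_prod _ k K (fun l u => poi (n%:R * uniform_on R k m l) u * c s t l u)).
    by rewrite mulr_sumr; apply: eq_bigr => f _; rewrite cE.
  under [RHS]eq_bigr do under eq_bigr do rewrite E1.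
  under [RHS]eq_bigr do rewrite exchange_big /=.
  rewrite [RHS]exchange_big /=; apply: eq_bigr => f _.
  set G := \prod_(l | _) _.
  transitivity (\sum_(s < K) P (box f) * (h s (f j) * G) * (val s == val (f i))%:R).
    by rewrite pick_val !ffunE.
  apply: eq_bigr => s _.
  transitivity (\sum_(t < K) P (box f) * (h s t * G) * (val s == val (f i))%:R * (val t == val (f j))%:R).
    by rewrite pick_val.
  by apply: eq_bigr => t _; rewrite (eq_sym (val s)) (eq_sym (val t)); ring.
rewrite mulr_sumr; apply: ler_sum => s _; rewrite mulr_sumr; apply: ler_sum => t _.
rewrite mulrA mulrC ler_wpM2l //.
set F := fun l => \sum_(u < K) poi (n%:R * uniform_on R k m l) u * c s t l u.
have Fi : F i = poi r s.
  rewrite /F /uniform_on im /c eqxx -/r.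
  by under eq_bigr do rewrite /=; exact: (pick_val s (fun u => poi r u)).
have Fj : F j = poi r t.
  rewrite /F /uniform_on jm /c (eq_sym j) (negbTE ij) eqxx -/r.
  exact: (pick_val t (fun u => poi r u)).
rewrite -Fi -Fj; apply: prod_ge_pow => //; rewrite ?Fi ?Fj ?poi_ge0 //.
move=> l li lj; rewrite /F /c (negbTE li) (negbTE lj) /uniform_on; case: ifP => // _.
rewrite mulr0 (bigD1 (Ordinal K0)) //= poi_0 eqxx mul1r g1 lerDl.
by rewrite sumr_ge0 // => u _; rewrite mulr_ge0 // poi_ge0.
Qed.

Lemma sum_distinct_pairs (c : R) : (m <= k)%N ->
  \sum_(i < k | (i < m)%N) \sum_(j < k | (j < m)%N && (j != i)) c
  = m%:R * (m%:R - 1) * c.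
Proof.
move=> mk; have E (b : R) : \sum_(i < k | (i < m)%N) b = m%:R * b.
  by rewrite -(big_ord_widen _ (fun=> b)) // sumr_const card_ord mulr_natl.
rewrite (eq_bigr (fun=> (m%:R - 1) * c)); first by rewrite E mulrA.
move=> i im; have := E c; rewrite (bigD1 i) //= => H.
by rewrite mulrBl -H mul1r [in RHS]addrAC subrr add0r.
Qed.

End BoxExpectation.


(** * Two symbols alone at adjacent counts *)

Section Isolated.
Variables (R : realType) (n y0 k : nat).
Hypothesis n_gt0 : (0 < n)%N.
Local Notation w := (@mgt_weight R n y0 k).

(* The profile of [N] is 1, 1, 0 at [y], [y + 1], [y + 2]. *)
Definition lone_pair (N : counts k) (y : nat) (i j : 'I_k) : bool :=
  [&& N i == y, N j == y.+1 &
    [forall l, (l != i) ==> (l != j) ==> (N l \notin [:: y; y.+1; y.+2])]].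

Lemma lone_pairP N y i j : lone_pair N y i j ->
  [/\ N i = y, N j = y.+1 &
    forall l, l != i -> l != j -> N l \notin [:: y; y.+1; y.+2]].
Proof.
move=> /and3P[/eqP Ni /eqP Nj /forallP H]; split=> // l li lj.
by have := H l; rewrite li lj.
Qed.

Lemma lone_pair_uniq N y i j i' j' :
  lone_pair N y i j -> lone_pair N y i' j' -> i' = i /\ j' = j.
Proof.
move=> /lone_pairP[Ni Nj H] /lone_pairP[Ni' Nj' _].
have yy : (y == y.+1) = false by rewrite eqn_leq ltnn andbF.
split; apply/eqP; apply: contraT => ne.
  have [e|ne'] := eqVneq i' j; first by move: Ni'; rewrite e Nj => /eqP; rewrite eq_sym yy.
  by have := H _ ne ne'; rewrite Ni' !inE eqxx.
have [e|ne'] := eqVneq j' i; first by move: Nj'; rewrite e Ni => /eqP; rewrite yy.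
by have := H _ ne' ne; rewrite Nj' !inE eqxx orbT.
Qed.

(** Puts the indicator into the form of an [h] times a product of values of [g], as in
    [box_pair_ge]. *)
Lemma lone_pair_weightE (N : counts k) y i j :
  ((N i == y) && (N j == y.+1))%:R *
    \prod_(l | (l != i) && (l != j)) (N l \notin [:: y; y.+1; y.+2])%:R
  = (lone_pair N y i j)%:R :> R.
Proof.
rewrite /lone_pair andbA; case: (_ && _) => /=; last by rewrite mul0r.
rewrite mul1r.
case: forallP => [H|H].
  rewrite big1 // => l /andP[li lj]; have := H l.
  by rewrite li lj /= => ->.
have /existsP[l] : [exists l, ~~ ((l != i) ==> (l != j) ==> (N l \notin [:: y; y.+1; y.+2]))].
  by rewrite -negb_forall; apply/negP => /forallP.
rewrite !negb_imply => /and4P[li lj Nl _].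
by rewrite (bigD1 l) ?li //= Nl mul0r.
Qed.

(* The alternative [y = 1] allows every threshold: the weights of the two symbols are then
   proportional to (4, 3), (4, 2) or (1, 2) according to [y0 >= 2], [y0 = 1] or [y0 = 0]. *)
Lemma lone_pair_dev N y i j : lone_pair N y i j -> (0 < y)%N ->
  (y < y0)%N || (y == 1)%N ->
  (49%:R)^-1 <= ((w N i - w N j) / (w N i + w N j)) ^+ 2.
Proof.
move=> /lone_pairP[Ni Nj H] y_gt0 yy0.
have yy : (y == y.+1) = false by rewrite eqn_leq ltnn andbF.
have yyy : (y.+1 == y.+2) = false by rewrite eqn_leq ltnn andbF.
have y2 : (y == y.+2) = false by rewrite ltn_eqF // ltnW.
have p0 : profile N y = 1%N.
  rewrite profileE; apply: (@fintype.eq_card1 _ i) => l; rewrite !inE.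
  have [->|li] := eqVneq l i; first by rewrite Ni eqxx.
  have [->|lj] := eqVneq l j; first by rewrite Nj eq_sym yy.
  by have := H l li lj; rewrite !inE => /norP[/negbTE ->].
have p1 : profile N y.+1 = 1%N.
  rewrite profileE; apply: (@fintype.eq_card1 _ j) => l; rewrite !inE.
  have [->|lj] := eqVneq l j; first by rewrite Nj eqxx.
  have [->|li] := eqVneq l i; first by rewrite Ni yy.
  by have := H l li lj; rewrite !inE => /norP[_ /norP[/negbTE ->]].
have p2 : profile N y.+2 = 0%N.
  rewrite profileE; apply: fintype.eq_card0 => l; rewrite !inE.
  have [->|lj] := eqVneq l j; first by rewrite Nj yyy.
  have [->|li] := eqVneq l i; first by rewrite Ni y2.
  by have := H l li lj; rewrite !inE => /norP[_ /norP[_ /negbTE ->]].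
have n0 : (0 : R) < n%:R by rewrite ltr0n.
have y1 : (1 : R) <= y%:R by rewrite ler1n.
(* For [y < y0] the relative deviation is [y / (3 y + 4)], smallest at [y = 1], where it is 1/7; the
   two remaining cases give 1/3. *)
have bound (a b : R) : 0 < a -> 0 < b -> (a + b <= 7 * (a - b)) || (a + b <= 7 * (b - a)) ->
    (49%:R)^-1 <= ((a / n%:R - b / n%:R) / (a / n%:R + b / n%:R)) ^+ 2.
  move=> a0 b0 ab; rewrite dev_scale //.
  rewrite expr_div_n ler_pdivlMr ?exprn_gt0 ?addr_gt0 //.
  by case/orP: ab => ab; nra.
have wi : w N i = (if (y <= y0)%N then 2 * (y%:R + 1) else y%:R) / n%:R.
  rewrite /mgt_weight Ni p0 p1 divr1 natr1; case: ifP => // _.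
  by rewrite mulrAC -[in RHS]mulrA mulrC; field; rewrite gt_eqF.
have wj : w N j = (if (y < y0)%N then y%:R + 2 else y%:R + 1) / n%:R.
  rewrite /mgt_weight Nj p1 p2 divr1 mulr1; case: ifP => _; last by rewrite natr1.
  by rewrite -addn2 natrD.
rewrite wi wj; case/orP: yy0 => [yy0|/eqP y_eq1].
  rewrite yy0 (ltnW yy0); apply: bound; lra.
by rewrite y_eq1; case: (y0) => [|[|t]] /=; apply: bound; lra.
Qed.

Lemma lone_pair_seen N y i j : lone_pair N y i j -> (0 < y)%N -> seen _ N i /\ seen _ N j.
Proof. by move=> /lone_pairP[Ni Nj _] y_gt0; rewrite /seen Ni Nj -lt0n. Qed.

Lemma lone_pair_gain N y i j : lone_pair N y i j -> i != j -> (0 < y)%N ->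
  (y < y0)%N || (y == 1)%N -> (49%:R)^-1 <= seen_gain _ _ (@MGT R n y0 k) N.
Proof.
move=> iso ij y_gt0 yy0; have [si sj] := lone_pair_seen _ _ _ _ iso y_gt0.
apply: le_trans (lone_pair_dev _ _ _ _ iso y_gt0 yy0) _.
exact: MGT_gain_pair.
Qed.

(** Writing the event as a sum over pairs lets expectations be taken pair by pair. By
    [lone_pair_uniq] at most one term is nonzero, so the gain of one pair covers the whole sum. *)
Lemma lone_pair_sum_gain N y (m : nat) : (0 < y)%N -> (y < y0)%N || (y == 1)%N ->
  \sum_(i < k | (i < m)%N) \sum_(j < k | (j < m)%N && (j != i))
    (lone_pair N y i j)%:R / 49%:R <= seen_gain _ _ (@MGT R n y0 k) N.
Proof.
move=> y_gt0 yy0.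
case: (pickP [pred ij : 'I_k * 'I_k | (ij.1 != ij.2) && lone_pair N y ij.1 ij.2])
    => [[i0 j0] /= /andP[ij0 iso]|none]; last first.
  rewrite big1; first by apply: log_mean_ge0 => i; exact: MGT_gt0.
  move=> i _; rewrite big1 // => j /andP[_ ji]; have := none (i, j).
  by rewrite /= eq_sym ji /= => ->; rewrite mul0r.
apply: le_trans (lone_pair_gain _ _ _ _ iso ij0 y_gt0 yy0).
apply: (@le_trans _ _ (\sum_i \sum_j ((i == i0)%:R * ((j == j0)%:R / 49%:R)))).
  rewrite big_mkcond; apply: ler_sum => i _; case: ifP => _; last first.
    by apply: sumr_ge0 => j _; rewrite !mulr_ge0.
  rewrite big_mkcond; apply: ler_sum => j _; case: ifP => _; last first.
    by rewrite !mulr_ge0.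
  rewrite mulrA ler_wpM2r //; case: (boolP (lone_pair N y i j)) => [iso'|_].
    by have [-> ->] := lone_pair_uniq _ _ _ _ _ _ iso iso'; rewrite !eqxx mulr1.
  by rewrite mulr_ge0.
rewrite (bigD1 i0) //= eqxx (bigD1 j0) //= eqxx !mul1r !big1 ?addr0 //.
  by move=> i /negbTE ->; rewrite big1 // => j _; rewrite mul0r.
by move=> j /negbTE ->; rewrite mul0r mulr0.
Qed.

End Isolated.


(** * Sums against indicators of points and windows *)

Section IndicatorSums.
Variable R : realType.

Lemma sum_ord_pick K (F : nat -> R) y : (y < K)%N ->
  \sum_(t < K) F t * (t == y :> nat)%:R = F y.
Proof.
move=> yK; rewrite (bigD1 (Ordinal yK)) //= eqxx mulr1 big1 ?addr0 // => t ty.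
by rewrite (negbTE (ty : val t != y)) mulr0.
Qed.

Lemma sum_ord_window K (F : nat -> R) a L : (forall t, 0 <= F t) ->
  \sum_(t < K) F t * (a <= t < a + L)%N%:R <= \sum_(i < L) F (a + i)%N.
Proof.
move=> F0; apply: (@le_trans _ _ (\sum_(t < K) \sum_(i < L) F t * (t == a + i :> nat)%N%:R)).
  apply: ler_sum => t _; case: (boolP (_ <= _ < _)%N) => [/andP[at_ tL]|_]; last first.
    by rewrite mulr0 sumr_ge0 // => i _; rewrite mulr_ge0.
  have tl : (t - a < L)%N by rewrite ltn_subLR.
  by rewrite (bigD1 (Ordinal tl)) //= subnKC // eqxx lerDl sumr_ge0 // => i _; rewrite mulr_ge0.
rewrite exchange_big; apply: ler_sum => i _ /=.
case: (ltnP (a + i) K) => aK; first by rewrite sum_ord_pick.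
rewrite big1 // => t _; rewrite [_ == _](_ : _ = false) ?mulr0 //.
by apply/negbTE; rewrite neq_ltn (leq_trans (ltn_ord t) aK).
Qed.

End IndicatorSums.

(** * A point where the Poisson mass is of order [1 / s] *)

Section PoissonLevel.
Variable R : realType.

(** [y] is the last point of mass at least [q = 1 / (16 s)]. The mass drops after [y], so [y + 1]
    exceeds [r]; it is also at most [4 s]. Hence the ratio [r / (y + 1)] of the masses at [y + 1]
    and [y] lies between 1/4 and 1, which transfers the bounds between the two points. *)
Lemma poi_level (s : nat) (r : R) : (8 <= s)%N -> s%:R <= r -> r <= s%:R + 2 ->
  exists y, [/\ (0 < y)%N, (y < 4 * s)%N,
    (16 * s%:R)^-1 <= poi r y & poi r y <= (4 * s%:R)^-1] /\
    [/\ (64 * s%:R)^-1 <= poi r y.+1, poi r y.+1 <= (16 * s%:R)^-1 &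
        poi r y.+2 <= (16 * s%:R)^-1].
Proof.
move=> s8 sr rs; have s8R : (8 : R) <= s%:R by rewrite (ler_nat R 8).
set S : R := s%:R in s8R sr rs *.
have r0 : 0 < r by lra.
have p0 t := poi_ge0 _ r t (ltW r0).
set q := (16 * S)^-1; have q0 : 0 < q by rewrite invr_gt0; lra.
have qS : q * S = 1 / 16 by rewrite /q; field; lra.
(* From [2 s + 4 >= 2 r] on, the masses at least halve at each step, and [s + 4] halvings bring them
   below [1 / (16 s)]. The condition [8 <= s] gives [Y <= 4 s]. *)
pose Y := (2 * s + 4 + (s + 4))%N.
have Ys : (Y <= 4 * s)%N by rewrite /Y; lia.
have high t : (Y <= t)%N -> poi r t < q.
  move=> Yt; have -> : t = (2 * s + 4 + (t - (2 * s + 4)))%N by rewrite subnKC //; lia.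
  set j := (t - _)%N; have jS : (s + 4 <= j)%N by rewrite /j; lia.
  have rb : 2 * r <= (2 * s + 4)%:R by rewrite natrD natrM -/S; lra.
  have := poi_upper_geo _ _ _ j (ltW r0) rb; set p := poi _ _ => pj.
  have pow : 16 * S < 2 ^+ j.
    have : (16 * s < 2 ^ j)%N.
      apply: leq_trans (leq_pexp2l (isT : 0 < 2)%N jS).
      by rewrite expnD mulnC ltn_pmul2r // ltn_expl.
    by rewrite -(ltr_nat R) natrM natrX.
  have pp : 0 < p by exact: poi_gt0.
  rewrite /q -div1r ltr_pdivlMr; last lra.
  by apply: lt_le_trans pj; rewrite mulrC ltr_pM2r.
(* Otherwise the points below [Y] carry at most [4 s q = 1 / 4] and the rest at most [2 q], too
   little for a total near 1. *)
have [y0 y0Y qy0] : exists2 t, (t < Y)%N & q <= poi r t.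
  apply: contrapT => none.
  have low t : (t < Y)%N -> poi r t <= q.
    by move=> tY; rewrite leNgt; apply/negP => qt; apply: none; exists t => //; exact: ltW.
  have e0 : (0 : R) < 1 / 4 by lra.
  have [K0 HK] := poi_sum_near1 _ _ _ (ltW r0) e0.
  have := HK (Y + K0)%N (leq_addl _ _); rewrite big_split_ord /=.
  have Yr : 2 * r <= Y%:R.
    apply: le_trans (_ : (2 * s + 4)%:R <= _); last by rewrite ler_nat leq_addr.
    by rewrite natrD natrM -/S; lra.
  have := poi_upper_tail _ _ _ K0 (ltW r0) Yr.
  have := high _ (leqnn Y).
  have : \sum_(i < Y) poi r i <= Y%:R * q.
    rewrite -[Y in Y%:R]card_ord mulr_natl -sumr_const; apply: ler_sum => i _; exact: low.
  have : Y%:R * q <= 1 / 4.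
    have YS : Y%:R <= 4 * S by rewrite /S -natrM ler_nat.
    apply: (@le_trans _ _ (4 * S * q)); first by rewrite ler_wpM2r // ltW.
    by rewrite -mulrA (mulrC S) qS; lra.
  have : q <= 1 / 128 by rewrite /q -div1r ler_pdivrMr; lra.
  lra.
have exP : exists t, q <= poi r t by exists y0.
have bnd t : q <= poi r t -> (t <= Y)%N.
  by move=> qt; rewrite leqNgt; apply/negP => /ltnW /high; rewrite ltNge qt.
have [y qy ymax] := ex_maxnP exP bnd.
have above t : (y < t)%N -> poi r t < q.
  by move=> yt; rewrite ltNge; apply/negP => /ymax; rewrite leqNgt yt.
have yY : (y < Y)%N by rewrite ltnNge; apply/negP => /high; rewrite ltNge qy.
have bE := poiS _ r y; have b1 := above _ (ltnSn y).
have Y0 : (0 : R) < y.+1%:R by rewrite ltr0n.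
have yr : r < y.+1%:R.
  rewrite ltNge; apply/negP => yr; move: b1; rewrite ltNge => /negP; apply.
  apply: le_trans qy _; rewrite bE ler_peMr //.
  by rewrite ler_pdivlMr // mul1r.
have y4 : y.+1%:R <= 4 * S.
  by rewrite /S -natrM ler_nat (leq_trans yY).
have bE' : poi r y.+1 * y.+1%:R = poi r y * r by rewrite bE -mulrA divfK ?gt_eqF.
have inv4 : (4 * S)^-1 = 4 * q by rewrite /q; field; lra.
have inv64 : (64 * S)^-1 = q / 4 by rewrite /q; field; lra.
exists y; rewrite inv4 inv64 -/q; split; split.
- by rewrite lt0n; apply/eqP => y_0; move: yr; rewrite y_0; lra.
- exact: leq_trans yY Ys.
- exact: qy.
- have : poi r y * S <= poi r y * r by rewrite ler_wpM2l.
  have : poi r y.+1 * y.+1%:R <= q * (4 * S) by rewrite ler_pM // ltW.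
  rewrite bE' => h1 h2; have S0 : 0 < S by lra.
  by rewrite -(ler_pM2r S0); apply: le_trans h2 (le_trans h1 _); lra.
- have h1 : q * S <= poi r y * r by rewrite ler_pM //; lra.
  have h2 : poi r y.+1 * y.+1%:R <= poi r y.+1 * (4 * S) by rewrite ler_wpM2l.
  rewrite bE' in h2; have S0 : 0 < S by lra.
  rewrite -(ler_pM2r S0) -(ler_pM2r (_ : 0 < 4)) //; lra.
- exact: ltW.
- by rewrite ltW // above // ltnW.
Qed.
End PoissonLevel.


(** * Lower bounds from lone pairs: small [n] and large thresholds *)

Section LowerBounds.
Variables (R : realType) (n y0 k : nat).
Hypothesis n_gt0 : (0 < n)%N.

(** Each of the [m (m - 1)] ordered pairs is alone at [y], [y + 1] with probability at least
    [x ^+ m] times the two masses, and then gains at least 1/49. The weight [1 / m] of the gain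
    cancels one factor [m]. *)
Lemma regret_ge_lone_pair m K y (x : R) :
  (1 < m <= k)%N -> (0 < y)%N -> (y < y0)%N || (y == 1)%N -> (y.+1 < K)%N ->
  0 <= x <= 1 ->
  x <= \sum_(t < K) poi (n%:R / m%:R) t * ((t : nat) \notin [:: y; y.+1; y.+2])%:R ->
  (((m%:R - 1) * x ^+ m * (poi (n%:R / m%:R) y * poi (n%:R / m%:R) y.+1) / 49%:R)%:E
    <= regret n k (@MGT R n y0 k))%E.
Proof.
move=> /andP[m1 mk] y_gt0 yy0 yK x01 xg; set r := n%:R / m%:R in xg *.
have m0 : (0 < m)%N by exact: ltnW.
have k0 : (0 < k)%N by exact: leq_trans mk.
have mR : (0 : R) < m%:R by rewrite ltr0n.
have mk0 : (0 < m <= k)%N by rewrite m0.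
apply: le_trans (regret_ge_box _ _ _ _ (MGT_PI _ _ _ _ n_gt0 k0) (MGT_gt0 _ _ _ _ n_gt0) _ K mk0).
rewrite lee_fin ler_pdivlMl //.
have P0 (N : counts k) : 0 <= poi_prob n (uniform_on R k m) N.
  by apply: poi_prob_ge0 => i; rewrite /uniform_on; case: ifP.
apply: (@le_trans _ _ (\sum_(f : {ffun 'I_k -> 'I_K}) poi_prob n (uniform_on R k m) (box f) *
    \sum_(i < k | (i < m)%N) \sum_(j < k | (j < m)%N && (j != i))
      (lone_pair k (box f) y i j)%:R / 49%:R)); last first.
  by apply: ler_sum => f _; rewrite ler_wpM2l // lone_pair_sum_gain.
under eq_bigr do rewrite mulr_sumr.
rewrite exchange_big /=.
under eq_bigr do under eq_bigr do rewrite mulr_sumr.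
under eq_bigr do rewrite exchange_big /=.
have -> : m%:R * ((m%:R - 1) * x ^+ m * (poi r y * poi r y.+1) / 49%:R) =
    m%:R * (m%:R - 1) * (x ^+ m * (poi r y * poi r y.+1) / 49%:R) by ring.
rewrite -(sum_distinct_pairs _ k) //; apply: ler_sum => i im; apply: ler_sum => j /andP[jm ji].
under eq_bigr do rewrite mulrA.
rewrite -mulr_suml ler_wpM2r //.
have ij : i != j by rewrite eq_sym.
pose g (t : nat) : R := (t \notin [:: y; y.+1; y.+2])%:R.
pose h (s t : nat) : R := ((s == y) && (t == y.+1))%:R.
have g1 : g 0%N = 1 by rewrite /g !inE !(eq_sym 0%N) (gtn_eqF y_gt0).
have K0 : (0 < K)%N by exact: leq_ltn_trans yK.
have := @box_pair_ge R n k m K i j g h x im jm ij mk x01 (fun=> ler0n _ _) (fun _ _ => ler0n _ _) K0 g1 xg.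
have -> : \sum_(s < K) \sum_(t < K) poi r s * poi r t * h s t = poi r y * poi r y.+1.
  rewrite -(sum_ord_pick _ K (fun s => poi r s * poi r y.+1) y) ?(ltnW yK) //.
  apply: eq_bigr => s _.
  rewrite -(sum_ord_pick _ K (fun t => poi r s * poi r t * (s == y :> nat)%:R) y.+1) //.
  by apply: eq_bigr => t _; rewrite /h -mulnb natrM mulrA.
move=> /le_trans; apply; rewrite le_eqVlt; apply/orP; left; apply/eqP.
by apply: eq_bigr => f _; rewrite lone_pair_weightE.
Qed.

Lemma regret_ge_small_n : (1 < n)%N -> (1 < k)%N ->
  ((expR (- (2 * n%:R)) / 98%:R)%:E <= regret n k (@MGT R n y0 k))%E.
Proof.
move=> n1 k1; have nR : (2 : R) <= n%:R by rewrite (ler_nat R 2).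
set r : R := n%:R / 2; have r1 : 1 <= r by rewrite /r; lra.
have x0 := expR_ge0 (- r).
have x1 : expR (- r) <= 1 by rewrite expR_le1; lra.
(* With [y = 1] and [K = 3] the only count below [K] outside [y], [y + 1], [y + 2] is 0, of mass
   [expR (- r)]. The bound becomes [expR (- 4 r) r ^ 3 / 98], and [r >= 1]. *)
apply: le_trans (regret_ge_lone_pair 2 3 1 (expR (- r)) _ _ _ _ _ _) => //.
- rewrite lee_fin -/r.
  have -> : expR (- (2 * n%:R)) = expR (- r) ^+ 4 :> R.
    by rewrite -expRM_natr; congr expR; rewrite /r; field.
  set e := expR (- r) in x0 x1 *.
  have -> : (2 - 1) * e ^+ 2 * (poi r 1 * poi r 2) = e ^+ 4 * (r ^+ 3 / 2).
    by rewrite /poi -/e !factS fact0 !natrM; field.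
  have : 0 <= e ^+ 4 * (r ^+ 3 - 1).
    by rewrite mulr_ge0 ?exprn_ge0 // subr_ge0 exprn_ege1.
  lra.
- by rewrite orbT.
- by rewrite x0 x1.
- rewrite !big_ord_recr big_ord0 /= add0r /poi -/r fact0 expr0 divr1 mul1r mulr1 -addrA lerDl.
  by rewrite addr_ge0 // mulr0.
Qed.

Lemma regret_ge_large_threshold (s : nat) : (8 <= s <= k)%N -> (s * s <= n)%N ->
  (n <= s * s + 2 * s)%N -> (4 * s <= y0)%N ->
  ((s%:R^-1 / (49%:R * 64%:R * 64%:R))%:E <= regret n k (@MGT R n y0 k))%E.
Proof.
move=> /andP[s8 sk] ssn nss sy0.
have s8R : (8 : R) <= s%:R by rewrite (ler_nat R 8).
have s0 : (0 : R) < s%:R by lra.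
set r : R := n%:R / s%:R.
have sr : s%:R <= r by rewrite ler_pdivlMr // -natrM ler_nat.
have rs : r <= s%:R + 2.
  by rewrite ler_pdivrMr // mulrDl -!natrM -natrD ler_nat.
have [y [[y_gt0 ys ya ya'] [yb yb' yc]]] := poi_level _ _ _ s8 sr rs.
have r0 : 0 <= r by lra.
have e0 : (0 : R) < (8 * s%:R)^-1 by rewrite invr_gt0; lra.
have [K0 HK] := poi_sum_near1 _ _ _ r0 e0.
pose K := (K0 + y.+3)%N.
(* In units of [1 / s], the masses at [y], [y + 1], [y + 2] cost at most 1/4, 1/16 and 1/16, and
   truncation at [K] at most 1/8: together 1/2. Bernoulli then keeps [x ^+ s] at least 1/2. *)
set x : R := 1 - (2 * s%:R)^-1.
have xs : (2 * s%:R)^-1 <= 1 / 16 :> R by rewrite -div1r ler_pdivrMr; lra.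
have x0 : 0 < (2 * s%:R)^-1 :> R by rewrite invr_gt0; lra.
have x01 : 0 <= x <= 1 by rewrite /x; lra.
apply: le_trans (regret_ge_lone_pair s K y x _ y_gt0 _ _ x01 _).
- rewrite lee_fin -/r.
  have xp : 1 / 2 <= x ^+ s.
    rewrite /x; apply: le_trans (bernoulli _ _ _ _); last by lra.
    by rewrite (_ : s%:R * (2 * s%:R)^-1 = 1 / 2); [lra|field; lra].
  set u : R := s%:R^-1; have u0 : 0 < u by rewrite invr_gt0.
  have us : u * s%:R = 1 by rewrite mulVf // gt_eqF.
  have u8 : u <= 1 / 2 by rewrite /u -div1r ler_pdivrMr; lra.
  have pa : u / 16 <= poi r y by apply: le_trans ya; rewrite /u -invfM mulrC.
  have pb : u / 64 <= poi r y.+1 by apply: le_trans yb; rewrite /u -invfM mulrC.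
  have h1 : u / 16 * (u / 64) <= poi r y * poi r y.+1 by rewrite ler_pM //; lra.
  have h2 : (s%:R - 1) * (1 / 2) <= (s%:R - 1) * x ^+ s by rewrite ler_wpM2l //; lra.
  have h3 : (s%:R - 1) * (1 / 2) * (u / 16 * (u / 64)) <=
      (s%:R - 1) * x ^+ s * (poi r y * poi r y.+1).
    by rewrite ler_pM //; [nra|nra].
  have h4 : (s%:R - 1) * (1 / 2) * (u / 16 * (u / 64)) = (u - u * u) / (32 * 64).
    rewrite (_ : u - u * u = (u * s%:R) * u - u * u); last by rewrite us mul1r.
    by field.
  have h5 : u * u <= u * (1 / 2) by rewrite ler_wpM2l // ltW.
  rewrite h4 in h3; rewrite -mulrA invfM mulrA mulrAC ler_wpM2r //; apply: le_trans h3; lra.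
- by rewrite sk (leq_trans _ s8).
- by rewrite (leq_trans ys).
- exact: leq_trans (leqnSn _) (leq_addl _ _).
rewrite -/r.
have yK : (y.+2 < K)%N by exact: leq_addl.
have := HK K (leq_addr _ _).
have -> : \sum_(t < K) poi r t * ((t : nat) \notin [:: y; y.+1; y.+2])%:R =
   \sum_(t < K) poi r t - poi r y - poi r y.+1 - poi r y.+2.
  rewrite -(sum_ord_pick _ K _ y.+2) // -(sum_ord_pick _ K _ y.+1) 1?ltnW //.
  rewrite -(sum_ord_pick _ K _ y) 1?ltnW 1?ltnW // -!sumrB; apply: eq_bigr => t _.
  rewrite !inE; have [->|] := eqVneq (t : nat) y.
    by rewrite !ltn_eqF //= !mulr0 mulr1 !subr0 subrr.
  have [->|] := eqVneq (t : nat) y.+1.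
    by rewrite (gtn_eqF (ltnSn y)) (ltn_eqF (ltnSn y.+1)) /= !mulr0 mulr1 !subr0 subrr.
  by case: (_ == y.+2) => _ _; rewrite /= !mulr0 ?mulr1 !subr0 ?subrr.
have -> : (8 * s%:R)^-1 = s%:R^-1 / 8 :> R by field; lra.
have e16 : (16 * s%:R)^-1 = s%:R^-1 / 16 :> R by field; lra.
have e4 : (4 * s%:R)^-1 = s%:R^-1 / 4 :> R by field; lra.
rewrite /x (_ : (2 * s%:R)^-1 = s%:R^-1 / 2); last by field; lra.
rewrite e16 in yb' yc; rewrite e4 in ya'; lra.
Qed.

End LowerBounds.


(** * Spread of two independent counts *)

Section Spread.
Variable R : realType.

(* Implied by [|u - v| < d]; the truncated [u - d] only enlarges the window. *)
Definition close (d u v : nat) : bool := (u - d <= v < u - d + 2 * d)%N.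

Definition spread (s d u v : nat) : bool :=
  [&& (4 * s <= u < 128 * s)%N, (4 * s <= v < 128 * s)%N & ~~ close d u v].

(** A union bound: of the truncated mass [Z >= 7 / 8], the part [A] outside [[4 s, 128 s)] is at
    most 3/16 and closeness costs at most 1/8. What remains is at least [Z (Z - 2 A - 1 / 8)]. *)
Lemma poi_spread (r : R) (s d K : nat) :
  16 * s%:R <= r -> r <= 64 * s%:R -> (0 < d)%N -> (128 * (d * d) <= s)%N ->
  7 / 8 <= \sum_(t < K) poi r t ->
  1 / 4 <= \sum_(u < K) \sum_(v < K) poi r u * poi r v * (spread s d u v)%:R.
Proof.
move=> sr rs d0 ds Z78.
have d1 : (1 : R) <= d%:R by rewrite ler1n.
have dsR : 128 * (d%:R * d%:R) <= s%:R :> R by rewrite -!natrM ler_nat.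
have r0 : 0 < r by nra.
have p0 t : 0 <= poi r t by exact: poi_ge0 (ltW r0).
have dp t : d%:R * poi r t <= 1 / 16.
  (* [poi_max] applies with [J = 32 d], as [2 (32 d) ^ 2 = 16 * 128 d ^ 2 <= 16 s <= r]. *)
  have H : 2 * ((32 * d) * (32 * d))%:R <= r by rewrite !natrM; nra.
  have d32 : (0 < 32 * d)%N by rewrite muln_gt0.
  by have := poi_max _ _ _ t d32 H; rewrite natrM; lra.
have p16 t : poi r t <= 1 / 16.
  by apply: le_trans (dp t); rewrite ler_peMl.
set Z := \sum_(t < K) poi r t in Z78 *.
have Z1 : Z <= 1 by exact: poi_sum_le1 (ltW r0).
(* Marks the values outside [[4 s, 128 s)] as two windows; the end [128 s + K] exceeds every value
   below [K]. *)
pose a (u : nat) : R := (0 <= u < 0 + 4 * s)%N%:R + (128 * s <= u < 128 * s + K)%N%:R.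
set A := \sum_(t < K) poi r t * a t.
have A316 : A <= 3 / 16.
  rewrite /A; under eq_bigr do rewrite /a mulrDr.
  rewrite big_split /=.
  have := sum_ord_window _ K _ 0 (4 * s) p0.
  have := sum_ord_window _ K _ (128 * s) K p0.
  have : \sum_(i < K) poi r (128 * s + i)%N <= 2 * poi r (128 * s).
    by apply: poi_upper_tail (ltW r0) _; rewrite natrM; lra.
  have : \sum_(i < 4 * s) poi r (0 + i)%N <= poi r (4 * s).
    by apply: poi_lower_tail r0 _; rewrite natrM; lra.
  have := p16 (4 * s)%N; have := p16 (128 * s)%N; lra.
have near_le (u : nat) : \sum_(v < K) poi r v * (close d u v)%:R <= 1 / 8.
  apply: le_trans (sum_ord_window _ K _ (u - d)%N (2 * d)%N p0) _.
  apply: (@le_trans _ _ (\sum_(i < 2 * d) (16 * d%:R)^-1)).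
    by apply: ler_sum => i _; rewrite -div1r ler_pdivlMr; have := dp (u - d + i)%N; lra.
  rewrite sumr_const card_ord -[_ *+ (2 * d)]mulr_natl natrM le_eqVlt; apply/orP; left; apply/eqP.
  by field; lra.
apply: (@le_trans _ _ (\sum_(u < K) poi r u * (Z - a u * Z - A - 1 / 8))).
  have -> : \sum_(u < K) poi r u * (Z - a u * Z - A - 1 / 8) =
      Z * (Z - A - 1 / 8) - A * Z.
    transitivity (\sum_(u < K) (poi r u * (Z - A - 1 / 8) - poi r u * a u * Z)).
      by apply: eq_bigr => u _; ring.
    by rewrite sumrB; congr (_ - _); rewrite -mulr_suml.
  by nra.
apply: ler_sum => u _.
apply: (@le_trans _ _ (\sum_(v < K) poi r u * (poi r v - a u * poi r v - poi r v * a v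
    - poi r v * (close d u v)%:R))).
  rewrite -mulr_sumr ler_wpM2l // !sumrB -mulr_sumr -/Z -/A.
  by have := near_le u; lra.
apply: ler_sum => v _; rewrite -mulrA ler_wpM2l //.
have -> : poi r v - a u * poi r v - poi r v * a v - poi r v * (close d u v)%:R =
   poi r v * (1 - a u - a v - (close d u v)%:R) by ring.
rewrite ler_wpM2l // /a /spread.
have uK : (u < 128 * s + K)%N by rewrite (leq_trans (ltn_ord u)) // leq_addl.
have vK : (v < 128 * s + K)%N by rewrite (leq_trans (ltn_ord v)) // leq_addl.
rewrite uK vK !andbT /= !add0n !(ltnNge _ (128 * s)) !(ltnNge _ (4 * s)).
by case: (4 * s <= u)%N; case: (4 * s <= v)%N; case: (128 * s <= u)%N;
  case: (128 * s <= v)%N; case: (close d u v); rewrite /=; lra.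
Qed.

(** The counts differ by at least [d], whose square is at least [s / 512], while their sum is at
    most [256 s]. *)
Lemma spread_dev (s d u v : nat) : (0 < d)%N -> (s <= 512 * (d * d))%N -> spread s d u v ->
  s%:R^-1 / (512%:R * 256%:R * 256%:R) <= ((u%:R - v%:R) / (u%:R + v%:R)) ^+ 2 :> R.
Proof.
move=> d0 sd /and3P[/andP[su us] /andP[sv vs] nc].
have d1 : (1 : R) <= d%:R by rewrite ler1n.
have sdR : s%:R <= 512 * (d%:R * d%:R) :> R by rewrite -!natrM ler_nat.
have s_gt0 : (0 < s)%N by case: (s) us.
have s0 : (0 : R) < s%:R by rewrite ltr0n.
have uR : 4 * s%:R <= u%:R :> R by rewrite -natrM ler_nat.
have vR : 4 * s%:R <= v%:R :> R by rewrite -natrM ler_nat.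
have uR' : u%:R <= 128 * s%:R :> R by rewrite -natrM ler_nat ltnW.
have vR' : v%:R <= 128 * s%:R :> R by rewrite -natrM ler_nat ltnW.
have far : (d%:R <= u%:R - v%:R :> R) || (d%:R <= v%:R - u%:R :> R).
  rewrite !lerBrDr -!natrD !ler_nat; move: nc; rewrite /close negb_and -ltnNge -leqNgt.
  case/orP => h; apply/orP.
    by left; clear -h; lia.
  by right; clear -h; lia.
have dev : d%:R * d%:R <= (u%:R - v%:R) ^+ 2 :> R by case/orP: far => ?; nra.
have sum : (u%:R + v%:R) ^+ 2 <= (256 * s%:R) ^+ 2 :> R.
  by rewrite ler_sqr ?nnegrE; lra.
rewrite expr_div_n ler_pdivlMr ?exprn_gt0 //; last lra.
apply: le_trans dev.
apply: (@le_trans _ _ (s%:R^-1 / (512%:R * 256%:R * 256%:R) * (256 * s%:R) ^+ 2)).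
  have si : 0 < s%:R^-1 :> R by rewrite invr_gt0.
  by apply: ler_wpM2l sum; lra.
rewrite (_ : _ * (256 * s%:R) ^+ 2 = s%:R / 512); last by field; lra.
lra.
Qed.

End Spread.


(** * Integer square roots, and the lower bound for small thresholds *)

Lemma sqrt_bracket (n : nat) : exists s, (s * s <= n)%N /\ (n <= s * s + 2 * s)%N.
Proof.
elim: n => [|n [s [sn ns]]]; first by exists 0%N.
have [e|ne] := eqVneq n (s * s + 2 * s)%N; last first.
  by exists s; split; [exact: leqW | rewrite ltn_neqAle ne].
exists s.+1; rewrite e; split; lia.
Qed.

Section SmallThreshold.
Variables (R : realType) (n y0 k : nat).
Hypothesis n_gt0 : (0 < n)%N.

(** On counts at least [4 s > y0] the weights are the empirical ones, so a spread pair deviates as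
    in [spread_dev]. There are [m (m - 1)] ordered pairs; [MGT_gain_all] costs a factor [2 m] and
    the weight of the gain another [m]. *)
Lemma regret_ge_spread m K (s d : nat) (x : R) :
  (1 < m <= k)%N -> (0 < s)%N -> (y0 < 4 * s)%N -> (0 < d)%N -> (s <= 512 * (d * d))%N ->
  0 <= x <= 1 -> (0 < K)%N -> x <= \sum_(t < K) poi (n%:R / m%:R) t ->
  1 / 4 <= \sum_(u < K) \sum_(v < K)
     poi (n%:R / m%:R : R) u * poi (n%:R / m%:R) v * (spread s d u v)%:R ->
  (((m%:R - 1) / (2 * m%:R) * (x ^+ m / 4) * (s%:R^-1 / (512%:R * 256%:R * 256%:R)))%:E
    <= regret n k (@MGT R n y0 k))%E.
Proof.
move=> /andP[m1 mk] s_gt0 ys d0 sd x01 K0 xZ; set r := n%:R / m%:R in xZ *.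
set c := s%:R^-1 / _ => H14.
have m0 : (0 < m)%N by exact: ltnW.
have k0 : (0 < k)%N by exact: leq_trans mk.
have mR : (0 : R) < m%:R by rewrite ltr0n.
have m1R : (1 : R) <= m%:R by rewrite ler1n.
have mk0 : (0 < m <= k)%N by rewrite m0.
have c0 : 0 <= c.
  have : 0 < s%:R^-1 :> R by rewrite invr_gt0 ltr0n.
  by rewrite /c; lra.
have p0 i : 0 <= uniform_on R k m i by rewrite /uniform_on; case: ifP.
have P0 (N : counts k) : 0 <= poi_prob n (uniform_on R k m) N by exact: poi_prob_ge0.
apply: le_trans (regret_ge_box _ _ _ _ (MGT_PI _ _ _ _ n_gt0 k0) (MGT_gt0 _ _ _ _ n_gt0) _ K mk0).
rewrite lee_fin ler_pdivlMl //.
(* Nonzero probability confines the seen symbols to the first [m], which bounds their number by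
   [m]. *)
have gain_ge (N : counts k) : poi_prob n (uniform_on R k m) N != 0 ->
    \sum_(i < k | (i < m)%N) \sum_(j < k | (j < m)%N && (j != i))
      c * (spread s d (N i) (N j))%:R <= 2 * m%:R * seen_gain R k (@MGT R n y0 k) N.
  move=> PN; apply: le_trans (_ : 2 * (#|seen k N|)%:R * seen_gain R k (@MGT R n y0 k) N <= _).
    apply: le_trans (MGT_gain_all _ _ _ _ n_gt0 N).
    rewrite big_mkcond [leRHS]big_mkcond /=; apply: ler_sum => i _.
    have s_sum : 0 <= \sum_(j < k | seen k N j)
        ((mgt_weight R n y0 N i - mgt_weight R n y0 N j) /
         (mgt_weight R n y0 N i + mgt_weight R n y0 N j)) ^+ 2 :> R.
      by apply: sumr_ge0 => j _; exact: sqr_ge0.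
    have ns0 : (4 * s <= 0)%N = false by apply/negbTE; rewrite -ltnNge muln_gt0.
    have unseen_l (j : 'I_k) : ~~ seen k N i -> spread s d (N i) (N j) = false.
      by rewrite negbK => /eqP ->; rewrite /spread ns0.
    have unseen_r (j : 'I_k) : ~~ seen k N j -> spread s d (N i) (N j) = false.
      by rewrite negbK => /eqP ->; rewrite /spread ns0 /= andbF.
    case: (boolP (seen k N i)) => si; last first.
      case: ifP => // _; rewrite big1 // => j _.
      by rewrite unseen_l // mulr0.
    case: ifP => [_|_]; last exact: s_sum.
    rewrite big_mkcond [leRHS]big_mkcond /=; apply: ler_sum => j _.
    case: (boolP (seen k N j)) => sj; last first.
      by case: ifP => // _; rewrite unseen_r // mulr0.
    case: ifP => [_|_]; last exact: sqr_ge0.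
    case: (boolP (spread _ _ _ _)) => [sp|_]; last by rewrite mulr0 sqr_ge0.
    have /and3P[/andP[ui _] /andP[vj _] _] := sp.
    have wE l : (4 * s <= N l)%N -> mgt_weight R n y0 N l = (N l)%:R / n%:R :> R.
      by move=> sl; rewrite /mgt_weight leqNgt (leq_trans ys sl).
    have Npos l : (4 * s <= N l)%N -> (0 : R) < (N l)%:R.
      by move=> sl; rewrite ltr0n (leq_trans _ sl) // muln_gt0.
    rewrite mulr1 !wE // dev_scale ?Npos ?ltr0n //.
    exact: (spread_dev _ _ _ _ _ d0 sd sp).
  rewrite ler_wpM2r //; first by apply: log_mean_ge0 => l; exact: MGT_gt0.
  rewrite ler_wpM2l // ler_nat -[m in (_ <= m)%N]card_ord.
  have sub (l : 'I_k) : seen k N l -> (l < m)%N.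
    move=> sl; rewrite ltnNge; apply/negP => ml.
    by move/eqP: PN; apply; exact: (poi_prob_unseen _ _ _ _ _ l).
  rewrite -!sum1_card (big_ord_widen _ (fun=> 1%N) mk) [X in (X <= _)%N]big_mkcond [X in (_ <= X)%N]big_mkcond.
  apply: leq_sum => l _; rewrite unfold_in; case: (boolP (N l != 0%N)) => [sl|_].
    by rewrite (sub l sl).
  by case: ifP.
apply: (@le_trans _ _ ((2 * m%:R)^-1 * \sum_(f : {ffun 'I_k -> 'I_K}) poi_prob n (uniform_on R k m) (box f) *
    \sum_(i < k | (i < m)%N) \sum_(j < k | (j < m)%N && (j != i))
      c * (spread s d (box f i) (box f j))%:R)); last first.
  rewrite ler_pdivrMl ?mulr_gt0 // mulr_sumr; apply: ler_sum => f _.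
  have [->|PN] := eqVneq (poi_prob n (uniform_on R k m) (box f)) 0.
    by rewrite !mul0r mulr0.
  by rewrite mulrCA ler_wpM2l // gain_ge.
under [X in _ <= _ * X]eq_bigr do rewrite mulr_sumr.
rewrite [X in _ <= _ * X]exchange_big /=.
under [X in _ <= _ * X]eq_bigr do under eq_bigr do rewrite mulr_sumr.
under [X in _ <= _ * X]eq_bigr do rewrite exchange_big /=.
have -> : m%:R * ((m%:R - 1) / (2 * m%:R) * (x ^+ m / 4) * c) =
    (2 * m%:R)^-1 * (m%:R * (m%:R - 1) * (c * (x ^+ m / 4))).
  by ring.
rewrite ler_pM2l ?invr_gt0 ?mulr_gt0 //.
rewrite -(sum_distinct_pairs _ k) //; apply: ler_sum => i im; apply: ler_sum => j /andP[jm ji].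
have ij : i != j by rewrite eq_sym.
have xg : x <= \sum_(t < K) poi r t * (fun=> 1) (t : nat).
  by under eq_bigr do rewrite mulr1.
(* With [g] constant, [x] only accounts for the truncation of the other counts at [K]. *)
have := @box_pair_ge R n k m K i j (fun=> 1) (fun u v => (spread s d u v)%:R) x im jm ij mk x01
  (fun=> ler01) (fun _ _ => ler0n _ _) K0 erefl xg.
rewrite -/r => H.
apply: (@le_trans _ _ (c * (\sum_(f : {ffun 'I_k -> 'I_K}) poi_prob n (uniform_on R k m) (box f) *
    (spread s d (box f i) (box f j))%:R))).
  rewrite ler_wpM2l //; apply: le_trans (le_trans H _).
    rewrite ler_wpM2l ?exprn_ge0 //; last by rewrite -div1r.
    by case/andP: x01.
  by apply: ler_sum => f _; rewrite big1 // mulr1.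
by rewrite mulr_sumr; apply: ler_sum => f _; rewrite mulrCA.
Qed.

Lemma regret_ge_small_threshold (s : nat) : (128 <= s <= k)%N -> (s * s <= n)%N ->
  (n <= s * s + 2 * s)%N -> (y0 < 4 * s)%N ->
  ((s%:R^-1 / (512%:R * 256%:R * 256%:R) / 32)%:E <= regret n k (@MGT R n y0 k))%E.
Proof.
move=> /andP[s128 sk] ssn nss ys.
have s_gt0 : (0 < s)%N by exact: leq_trans s128.
(* The mean count [r = n / m] then lies between [16 s] and [64 s], the range of [poi_spread]. *)
pose m := (s %/ 16)%N.
have ms : (m * 16 <= s)%N by exact: leq_divM.
have sm : (s <= 32 * m)%N.
  have := divn_eq s 16; have := ltn_mod s 16; rewrite -/m => h e.
  have m8 : (8 <= m)%N by rewrite /m -[8%N]/(128 %/ 16)%N leq_div2r.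
  by clear -h e m8; lia.
have m8 : (8 <= m)%N by rewrite /m -[8%N]/(128 %/ 16)%N leq_div2r.
have m1k : (1 < m <= k)%N.
  rewrite (leq_trans _ m8) //= (leq_trans _ sk) // (leq_trans _ ms) // leq_pmulr //.
have m8R : (8 : R) <= m%:R by rewrite (ler_nat R 8).
have m0 : (0 : R) < m%:R by lra.
set r : R := n%:R / m%:R.
have r16 : 16 * s%:R <= r.
  rewrite ler_pdivlMr // -!natrM ler_nat; apply: leq_trans ssn.
  by rewrite mulnAC leq_pmul2r // mulnC.
have r64 : r <= 64 * s%:R.
  rewrite ler_pdivrMr // -!natrM ler_nat; apply: leq_trans nss _.
  have s2 : (2 <= s)%N by exact: leq_trans s128.
  apply: leq_trans (_ : s * s + s * s <= _)%N; first by rewrite leq_add2l leq_mul2r s2 orbT.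
  rewrite addnn -mul2n (_ : 64 * s * m = 2 * (32 * m * s))%N; last by ring.
  by rewrite leq_pmul2l // leq_pmul2r.
(* This [d] satisfies [128 d ^ 2 <= s <= 512 d ^ 2]: the first for [poi_spread], the second for
   [spread_dev]. *)
have [d [dq qd]] := sqrt_bracket (s %/ 128).
have q1 : (0 < s %/ 128)%N by rewrite divn_gt0.
have d0 : (0 < d)%N.
  by case: d dq qd => // _; rewrite leqNgt q1.
have ds : (128 * (d * d) <= s)%N.
  by rewrite mulnC; apply: leq_trans (leq_divM s 128); rewrite leq_mul2r dq orbT.
have sd : (s <= 512 * (d * d))%N.
  have := divn_eq s 128; have := ltn_mod s 128 => h e.
  have dd : (d <= d * d)%N by rewrite leq_pmulr.
  move: (s %/ 128)%N (s %% 128)%N (d * d)%N e h dq qd dd => q t e2 e h dq qd dd.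
  have : (q <= 3 * e2)%N by clear -qd dd; lia.
  by clear -e h d0 dd; lia.
have r0 : 0 <= r by rewrite divr_ge0.
have e0 : (0 : R) < (2 * m%:R)^-1 by rewrite invr_gt0; lra.
have [K0 HK] := poi_sum_near1 _ _ _ r0 e0.
have mi : (2 * m%:R)^-1 <= 1 / 16 :> R by rewrite -div1r ler_pdivrMr; lra.
set x : R := 1 - (2 * m%:R)^-1.
have x01 : 0 <= x <= 1 by rewrite /x; lra.
have xZ : x <= \sum_(t < K0.+1) poi r t by apply: HK.
have Z78 : 7 / 8 <= \sum_(t < K0.+1) poi r t by apply: le_trans xZ; rewrite /x; lra.
have sp := poi_spread _ _ _ _ _ r16 r64 d0 ds Z78.
apply: le_trans (regret_ge_spread m K0.+1 s d x m1k s_gt0 ys d0 sd x01 _ xZ sp) => //.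
rewrite lee_fin; set c := s%:R^-1 / _.
have c0 : 0 <= c.
  have : 0 < s%:R^-1 :> R by rewrite invr_gt0 ltr0n.
  by rewrite /c; lra.
rewrite mulrC ler_wpM2r //.
(* The final factor 1/32 is the product of [(m - 1) / (2 m) >= 1 / 4] and [x ^+ m / 4 >= 1 / 8]. *)
have xp : 1 / 2 <= x ^+ m.
  rewrite /x; apply: le_trans (bernoulli _ _ _ _); last by lra.
  by rewrite (_ : m%:R * (2 * m%:R)^-1 = 1 / 2); [lra|field; lra].
have : 1 / 4 <= (m%:R - 1) / (2 * m%:R) :> R by rewrite ler_pdivlMr; lra.
set w := _ / (2 * _) => hw; nra.
Qed.

End SmallThreshold.

(** * Choice of the constant and combination of the three regimes *)

Theorem theorem2 (R : realType) (C : R) (hC : 0 < C) :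
  exists c : R, 0 < c /\
    forall (n k y0 : nat),
      (2 <= n)%N ->
      Num.sqrt (n%:R : R) <= k%:R ->
      (k%:R : R) <= (n%:R : R) `^ C ->
      ((c / Num.sqrt (n%:R * ln (n%:R : R)))%:E <= regret n k (MGT n y0 k))%E.
Proof.
(* The exponential serves the range [n <= 128 ^ 2]; the other factors bring [2 c / s] below each of
   the three lower bounds. *)
pose c : R := expR (- (2 * (128%:R * 128%:R))) / (512%:R * 256%:R * 256%:R) / 98%:R / 2.
have c0 : 0 < c.
  by have := expR_gt0 (- (2 * (128%:R * 128%:R)) : R); rewrite /c; lra.
exists c; split=> // n k y0 n2 nk _.
have n0 : (0 < n)%N by exact: ltnW.
have nR : (2 : R) <= n%:R by rewrite (ler_nat R 2).
have nkk : (n <= k * k)%N.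
  have h : 0 <= Num.sqrt (n%:R : R) by exact: sqrtr_ge0.
  rewrite -(ler_nat R) natrM -[n%:R]sqr_sqrtr // expr2; exact: ler_pM.
have [s [ssn nss]] := sqrt_bracket n.
have sk : (s <= k)%N by rewrite -leq_sqr -!mulnn (leq_trans ssn).
have s1 : (0 < s)%N by case: s ssn nss sk => // _; rewrite leqNgt n0.
have s1R : (1 : R) <= s%:R by rewrite ler1n.
have k1 : (1 < k)%N by case: k nk nkk sk => [|[|k]] //= _ h; move: (leq_trans n2 h).
(* Every regime is compared with [2 c / s]. As [ln n >= 1 - 1 / n >= 1 / 2], the root of [n ln n] is
   at least [s / 2]. *)
have small : c / Num.sqrt (n%:R * ln (n%:R : R)) <= 2 * c * s%:R^-1.
  have ln_half : 1 / 2 <= ln (n%:R : R).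
    have : 0 < (n%:R)^-1 :> R by rewrite invr_gt0; lra.
    move=> i0; have := ln_le_subr1 _ _ i0; rewrite lnV ?posrE; last lra.
    have : (n%:R)^-1 <= 1 / 2 :> R by rewrite -div1r ler_pdivrMr; lra.
    lra.
  have root : s%:R / 2 <= Num.sqrt (n%:R * ln (n%:R : R)).
        apply: (@le_trans _ _ (Num.sqrt ((s%:R / 2) ^+ 2))); first by rewrite sqrtr_sqr ler_norm.
    have ssR : s%:R * s%:R <= n%:R :> R by rewrite -natrM ler_nat.
    rewrite ler_wsqrtr //; apply: (@le_trans _ _ (n%:R * (1 / 2))); first by nra.
    by rewrite ler_wpM2l.
  have s0 : 0 < s%:R / 2 :> R by lra.
  have r0 := lt_le_trans s0 root.
  rewrite ler_pdivrMr //; set X := Num.sqrt _ in root r0 *.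
  rewrite (_ : 2 * c * s%:R^-1 * X = c * (2 * (s%:R^-1 * X))); last by ring.
  rewrite ler_peMr //; first exact: ltW.
  apply: (@le_trans _ _ (2 * (s%:R^-1 * (s%:R / 2)))).
    by rewrite le_eqVlt; apply/orP; left; apply/eqP; field; lra.
  by rewrite ler_pM2l // ler_pM2l ?invr_gt0 //; lra.
apply: (@le_trans _ _ (2 * c * s%:R^-1)%:E); first by rewrite lee_fin.
have si0 : 0 < s%:R^-1 :> R by rewrite invr_gt0; lra.
have e1 : expR (- (2 * (128%:R * 128%:R))) <= 1 :> R by rewrite expR_le1; lra.
case: (ltnP s 128) => s128.
  apply: le_trans (regret_ge_small_n _ _ _ _ n0 n2 k1); rewrite lee_fin.
  have : expR (- (2 * (128%:R * 128%:R))) <= expR (- (2 * n%:R)) :> R.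
    rewrite ler_expR lerN2 ler_pM2l // -natrM ler_nat; apply: leq_trans nss _.
    have s127 : (s <= 127)%N by [].
    apply: leq_trans (_ : 127 * 127 + 2 * 127 <= _)%N => //.
    by rewrite leq_add // ?leq_mul // leq_mul2l.
  have : s%:R^-1 <= 1 :> R by rewrite invf_le1 //; lra.
  rewrite /c; set e := expR _; set e' := expR _; move: (expR_gt0 (- (2 * (128%:R * 128%:R)) : R)); rewrite -/e.
  set i := s%:R^-1 in si0 *; move=> e0 i1 ee.
  have : e * i <= e by rewrite ler_piMr // ltW.
  lra.
have q0 : expR (- (2 * (128%:R * 128%:R))) * s%:R^-1 <= s%:R^-1 :> R by rewrite ler_piMl // ltW.
case: (leqP (4 * s) y0) => sy.
  have s8 : (8 <= s <= k)%N by rewrite (leq_trans _ s128).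
  apply: le_trans (regret_ge_large_threshold _ _ _ _ n0 _ s8 ssn nss sy).
  by rewrite lee_fin /c; move: q0; set e := expR _; set i := s%:R^-1 in si0 *; lra.
have s8 : (128 <= s <= k)%N by rewrite s128.
apply: le_trans (regret_ge_small_threshold _ _ _ _ n0 _ s8 ssn nss sy).
by rewrite lee_fin /c; move: q0; set e := expR _; set i := s%:R^-1 in si0 *; lra.
Qed.
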